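(* Let $(P_t)_{t\ge 0}$ be the transition semigroup on $L^2(\mu)$ of a (possibly non-reversible) time-homogeneous Markov process with invariant probability measure $\mu$, and let $(\mathcal L,\mathrm{Dom}(\mathcal L))$ be its generator in $L^2(\mu)$. Let $\nu,T\in(0,\infty)$. The following assertions are equivalent: (i) The semigroup $(P_t)_{t\ge0}$ satisfies a flow Poincaré inequality with constant $\nu^{-1}$ and duration $T$, i.e. $$\int_0^T\lVert P_t f\rVert_{L^2(\mu)}^2\,dt\ \le\ \frac1\nu\int_0^T\langle P_tf,-\mathcal L P_tf\rangle_{L^2(\mu)}\,dt\qquad\text{for all } f\in L_0^2(\mu)\cap\mathrm{Dom}(\mathcal L).$$ (ii) For all $f\in L_0^2(\mu)$ and $t\ge0$, $$\int_t^{t+T}\lVert P_sf\rVert_{L^2(\mu)}^2\,ds\ \le\ e^{-2\nu t}\int_0^T\lVert P_sf\rVert_{L^2(\mu)}^2\,ds .$$ Furthermore, both (i) and (ii) imply $$\lVert P_tf\rVert_{L^2(\mu)}\ \le\ C e^{-\nu t}\lVert f\rVert_{L^2(\mu)}\qquad\text{with } C=e^{\nu T},$$ for all $f\in L_0^2(\mu)$ and $t\ge0$.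
   Context: $L^2(\mu)$ is the real $L^2$ space, and $L_0^2(\mu)=\{f\in L^2(\mu):\int f\,d\mu=0\}$. The transition semigroup is viewed as a strongly continuous contraction semigroup on $L^2(\mu)$. *)

(* Defs.v *)
From HB Require Import structures.
From mathcomp Require Import all_boot all_order all_algebra.
From mathcomp Require Import all_classical all_reals all_analysis.

Set Implicit Arguments.
Unset Strict Implicit.
Unset Printing Implicit Defensive.
Import Order.TTheory GRing.Theory Num.Theory.
Import numFieldNormedType.Exports.

Local Open Scope classical_set_scope.
Local Open Scope ring_scope.

(* Elements of L^2(mu) are represented by functions f with
   f \in Lfun mu 2%:E; no definition below depends on the choice of a
   representative, except [generator], which picks one. *)

Definition L2norm (d : measure_display) (E : measurableType d) (R : realType)
    (mu : probability E R) (f : E -> R) : R :=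
  fine 'N[mu]_2%:E[EFin \o f]%E.

Definition L2inner (d : measure_display) (E : measurableType d) (R : realType)
    (mu : probability E R) (f g : E -> R) : R :=
  \int[mu]_x (f x * g x).

Definition L2 (d : measure_display) (E : measurableType d) (R : realType)
    (mu : probability E R) : set (E -> R) :=
  [set f | f \in Lfun mu 2%:E].

Definition L20 (d : measure_display) (E : measurableType d) (R : realType)
    (mu : probability E R) : set (E -> R) :=
  [set f | L2 mu f /\ \int[mu]_x f x = 0].

(* The transition function of a time-homogeneous Markov process: p t x A is
   the probability of being in A at time t when starting from x.  Only the
   kernels p t with 0 <= t matter.  The second condition is the
   Chapman-Kolmogorov equation
     p (s + t) x A = \int[p s x]_y p t y A. *)
Definition transition_function (d : measure_display) (E : measurableType d)
    (R : realType) (p : R -> R.-pker E ~> E) : Prop :=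
  (forall x (A : set E), measurable A -> p 0 x A = \d_x A) /\
  (forall s t x (A : set E), 0 <= s -> 0 <= t -> measurable A ->
     p (s + t) x A = kcomp_noparam (p s) (p t) x A).

Definition invariant_probability (d : measure_display) (E : measurableType d)
    (R : realType) (p : R -> R.-pker E ~> E) (mu : probability E R) : Prop :=
  forall t (A : set E), 0 <= t -> measurable A ->
    (\int[mu]_x p t x A = mu A)%E.

(* For f in L^2(mu), invariance of mu makes f integrable with respect to
   p t x for mu-almost every x; elsewhere the value is irrelevant. *)
Definition transition_op (d : measure_display) (E : measurableType d)
    (R : realType) (p : R -> R.-pker E ~> E) (t : R) (f : E -> R) : E -> R :=
  fun x => \int[p t x]_y f y.

(* Only strong continuity at 0 has to be required: that the P_t form a
   semigroup of contractions of L^2(mu) follows from the Chapman-Kolmogorov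
   equation, Jensen's inequality and the invariance of mu. *)
Definition strongly_continuous (d : measure_display) (E : measurableType d)
    (R : realType) (p : R -> R.-pker E ~> E) (mu : probability E R) : Prop :=
  forall f, L2 mu f ->
    L2norm mu (fun x => transition_op p h f x - f x) @[h --> 0^'+] --> (0 : R).

Definition generator_rel (d : measure_display) (E : measurableType d)
    (R : realType) (p : R -> R.-pker E ~> E) (mu : probability E R)
    (f g : E -> R) : Prop :=
  [/\ L2 mu f, L2 mu g &
    L2norm mu (fun x => h^-1 * (transition_op p h f x - f x) - g x)
      @[h --> 0^'+] --> (0 : R)].

Definition generator_dom (d : measure_display) (E : measurableType d)
    (R : realType) (p : R -> R.-pker E ~> E) (mu : probability E R) :
    set (E -> R) :=
  [set f | exists g, generator_rel p mu f g].

(* A representative of L f, which is unique up to mu-almost everywhere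
   equality; the default value 0 is used outside the domain. *)
Definition generator (d : measure_display) (E : measurableType d)
    (R : realType) (p : R -> R.-pker E ~> E) (mu : probability E R)
    (f : E -> R) : E -> R :=
  xget (cst 0) [set g | generator_rel p mu f g].

Definition flow_poincare (d : measure_display) (E : measurableType d)
    (R : realType) (p : R -> R.-pker E ~> E) (mu : probability E R)
    (C T : R) : Prop :=
  forall f, L20 mu f -> generator_dom p mu f ->
    \int[lebesgue_measure]_(t in `[0, T]) L2norm mu (transition_op p t f) ^+ 2
    <= C * \int[lebesgue_measure]_(t in `[0, T])
         L2inner mu (transition_op p t f)
           (fun x => - generator p mu (transition_op p t f) x).

(* Main.v *)
(* Write N(t) = |P_t f|^2 and F(t) = \int_t^{t+T} N.  If f is in the domain of
   the generator L, then N' = 2 <P_t f, L P_t f>, so (i) for P_t f reads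
   F(t) <= (N(t) - N(t + T)) / (2 nu) = - F'(t) / (2 nu), and Gronwall's lemma
   gives (ii); a general f is approximated by the averages
   h^-1 \int_0^h P_s f ds, which lie in the domain.  Conversely (ii) is an
   equality at t = 0, and comparing the derivatives there gives (i).  The
   pointwise decay follows from (ii) because N is nonincreasing, so that
   T N(t) <= F(t - T) for t >= T.

   The vector-valued integral is obtained as the limit of Riemann sums, whose
   convergence is tested against inner products; this only requires L^2 to be
   complete.  Continuity and differentiability in time always hold uniformly
   on [0, +oo[, so all calculus is done with explicit increments. *)

Require Import Defs.
From HB Require Import structures.
From mathcomp Require Import all_boot all_order all_algebra.
From mathcomp Require Import all_classical all_reals all_analysis.
From mathcomp Require Import measurable_realfun ring lra.

Set Implicit Arguments.
Unset Strict Implicit.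
Unset Printing Implicit Defensive.
Import Order.TTheory GRing.Theory Num.Theory.
Import numFieldNormedType.Exports.

Local Open Scope classical_set_scope.
Local Open Scope ring_scope.

(** * Riemann sums and Gronwall's lemma with explicit moduli *)

Section uniform_modulus.
Context {R : realType}.
Implicit Types (m D F : R -> R).
Local Notation lam := (@lebesgue_measure R).

(** Only forward increments from nonnegative times occur, because the semigroup is controlled for no
    other times; the bound is uniform on the half-line. *)
Definition modulus m (e d : R) :=
  forall s h : R, 0 <= s -> 0 <= h -> h <= d -> `|m (s + h) - m s| <= e.

Definition ucont m := forall e, 0 < e -> exists2 d : R, 0 < d & modulus m e d.

(** Nothing is known of [m] at negative times, so it is replaced by the even function [m |s|], which
    is continuous on the whole line and agrees with [m] on the interval. *)
Lemma ucont_integrable m (a b : R) : ucont m -> 0 <= a ->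
  lam.-integrable `[a, b] (EFin \o m).
Proof.
move=> um a0.
have cm : continuous (fun s : R => m `|s|).
  move=> s; apply/cvgrPdist_le => /= e e0.
  have [d d0 md] := um _ e0.
  near=> t.
  have std : `|s - t| <= d by near: t; exact: cvgr_dist_le.
  have nst : `| `|s| - `|t| | <= d by apply: le_trans std; exact: ler_dist_dist.
  have [st|st] := leP `|s| `|t|.
    rewrite distrC; have := md `|s| (`|t| - `|s|) (normr_ge0 _).
    by rewrite subr_ge0 st subrKC; apply => //; move: nst; rewrite ler_norml; lra.
  have := md `|t| (`|s| - `|t|) (normr_ge0 _).
  by rewrite subr_ge0 ltW// subrKC; apply => //; move: nst; rewrite ler_norml; lra.
have : lam.-integrable `[a, b] (EFin \o (fun s : R => m `|s|)).
  apply: continuous_compact_integrable; first exact: segment_compact.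
  exact: continuous_subspaceT.
apply: eq_integrable => // s; rewrite inE /= in_itv /= => /andP[as_ _].
by rewrite ger0_norm// (le_trans a0).
Unshelve. all: by end_near. Qed.

Lemma Rintegral_split m (a b c : R) : ucont m -> 0 <= a -> a <= b -> b <= c ->
  \int[lam]_(s in `[a, c]) m s =
  \int[lam]_(s in `[a, b]) m s + \int[lam]_(s in `[b, c]) m s.
Proof.
move=> um a0 ab bc.
have im x : 0 <= x -> lam.-integrable `[x, c] (EFin \o m).
  exact: ucont_integrable.
apply/eqP; rewrite addrC -subr_eq; apply/eqP.
rewrite Rintegral_itvB//; last exact: im.
by rewrite Rintegral_itv_obnd_cbnd//; apply: integrableS (im b _) => //;
  [exact: subset_itv_oc_cc|exact: le_trans ab].
Qed.

Lemma Rintegral_itv_cst (a b c : R) : a <= b ->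
  \int[lam]_(s in `[a, b]) c = c * (b - a).
Proof.
move=> ab; rewrite Rintegral_cst//= lebesgue_measure_itv/= lte_fin.
by case: ltP => //= ba; congr (_ * _); apply/eqP; lra.
Qed.

(** The fundamental theorem of calculus as an increment estimate: [m] is the derivative of its
    primitive, uniformly in [s]. *)
Lemma Rintegral_modulus m (e d s h : R) : ucont m -> modulus m e d ->
  0 <= s -> 0 <= h -> h <= d ->
  `|\int[lam]_(u in `[s, s + h]) m u - h * m s| <= e * h.
Proof.
move=> um md s0 h0 hd.
have sh : s <= s + h by rewrite lerDl.
have -> : h * m s = \int[lam]_(u in `[s, s + h]) m s.
  by rewrite Rintegral_itv_cst// addrAC subrr add0r mulrC.
have im := ucont_integrable (s + h) um s0.
have ic (c : R) : lam.-integrable `[s, s + h] (EFin \o cst c).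
  apply: continuous_compact_integrable; first exact: segment_compact.
  by apply: continuous_subspaceT => x; exact: cvg_cst.
rewrite -RintegralB//; last exact: ic.
have id : lam.-integrable `[s, s + h] (EFin \o (fun u => m u - m s)).
  by have := integrableB _ im (ic (m s)); apply.
apply: (le_trans (le_normr_Rintegral _ id)) => //.
have -> : e * h = \int[lam]_(u in `[s, s + h]) e.
  by rewrite Rintegral_itv_cst// addrAC subrr add0r.
apply: le_Rintegral => //.
- exact: (integrable_norm id).
- exact: ic.
move=> u /=; rewrite in_itv/= => /andP[su ush].
by have := md s (u - s) s0; rewrite subr_ge0 subrKC; apply => //; lra.
Qed.

(** Each of the [n.+1] steps contributes an error of at most [e] times the mesh, and the errors add
    up to [e * t]. *)
Lemma telescope_modulus D m (e d t : R) (n : nat) : 0 <= t -> t / n.+1%:R <= d ->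
  (forall s h : R, 0 <= s -> 0 <= h -> h <= d ->
    `|D (s + h) - D s - h * m s| <= e * h) ->
  `|D t - D 0 - \sum_(k < n.+1) t / n.+1%:R * m (k%:R * (t / n.+1%:R))| <= e * t.
Proof.
move=> t0 tnd Dm; set h := t / n.+1%:R.
have h0 : 0 <= h by rewrite divr_ge0.
suff H k : `|D (k%:R * h) - D 0 - \sum_(i < k) h * m (i%:R * h)| <= e * (k%:R * h).
  by have := H n.+1; rewrite /h mulrCA divff ?mulr1// pnatr_eq0.
elim: k => [|k IH].
  by rewrite big_ord0 !mul0r subrr subr0 normr0 mulr0.
rewrite big_ord_recr/=.
have kh0 : 0 <= k%:R * h by rewrite mulr_ge0.
have := Dm (k%:R * h) h kh0 h0 tnd.
have -> : k%:R * h + h = k.+1%:R * h by rewrite -natr1 mulrDl mul1r.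
move=> Dk.
have -> : e * (k.+1%:R * h) = e * (k%:R * h) + e * h.
  by rewrite -natr1 mulrDl mul1r mulrDr.
apply: le_trans (lerD IH Dk); apply: le_trans (ler_normD _ _).
by rewrite le_eqVlt; apply/orP; left; apply/eqP; congr `|_|; ring.
Qed.

Lemma small_mesh (t d : R) : 0 < d ->
  exists n0, forall n, (n0 <= n)%N -> t / n.+1%:R <= d.
Proof.
move=> d0; exists (Num.trunc (`|t| / d)).+1 => n n0n.
rewrite ler_pdivrMr// mulrC -ler_pdivrMr//.
apply: (@le_trans _ _ (`|t| / d)); first by rewrite ler_pM2r ?invr_gt0// ler_norm.
apply: (@le_trans _ _ (Num.trunc (`|t| / d)).+1%:R).
  by apply/ltW; rewrite Num.Theory.truncnS_gt.
by rewrite ler_nat (leq_trans n0n).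
Qed.

Lemma Riemann_sum_modulus m (e d t : R) n : ucont m -> modulus m e d ->
  0 <= t -> t / n.+1%:R <= d ->
  `|\int[lam]_(s in `[0, t]) m s -
    \sum_(k < n.+1) t / n.+1%:R * m (k%:R * (t / n.+1%:R))| <= e * t.
Proof.
move=> um md t0 tnd.
have := @telescope_modulus (fun t => \int[lam]_(s in `[0, t]) m s) m e d t n t0 tnd.
rewrite /= set_itv1 Rintegral_set1 subr0; apply => s h s0 h0 hd.
rewrite (@Rintegral_split m 0 s) ?lexx ?lerDl//.
have := Rintegral_modulus um md s0 h0 hd; apply: le_trans.
by rewrite le_eqVlt; apply/orP; left; apply/eqP; congr `|_|; ring.
Qed.

(** The integral of [m] and the increment of [D] are both close to the same Riemann sum, by
    [Riemann_sum_modulus] and [telescope_modulus]. *)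
Lemma Rintegral_of_uniform_derivative D m : ucont m ->
  (forall e, 0 < e -> exists2 d : R, 0 < d & forall s h : R, 0 <= s -> 0 <= h -> h <= d ->
    `|D (s + h) - D s - h * m s| <= e * h) ->
  forall t, 0 <= t -> \int[lam]_(s in `[0, t]) m s = D t - D 0.
Proof.
move=> um Dm t t0; apply/eqP; rewrite -subr_eq0 -normr_le0.
apply/ler_addgt0Pr => e e0; rewrite add0r.
(* The factor 2 accounts for the two comparisons with the Riemann sum; [t + 1] replaces [t] to cover
   [t = 0]. *)
pose e' := e / (2 * (t + 1)).
have e'0 : 0 < e' by rewrite divr_gt0//; lra.
have e'e : e' * t + e' * t <= e.
  have -> : e' * t + e' * t = e * (t / (t + 1)).
    by rewrite /e'; field; lra.
  by rewrite ler_piMr ?(ltW e0)// ler_pdivrMr ?mul1r; lra.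
have [d1 d10 md] := um _ e'0; have [d2 d20 Dd] := Dm _ e'0.
have [n1 n1P] := small_mesh t d10; have [n2 n2P] := small_mesh t d20.
pose n := maxn n1 n2.
have A := Riemann_sum_modulus um md t0 (n1P n (leq_maxl _ _)).
have B := telescope_modulus t0 (n2P n (leq_maxr _ _)) Dd.
apply: le_trans e'e; apply: le_trans (lerD A B).
apply: le_trans (ler_normB _ _).
by rewrite le_eqVlt; apply/orP; left; apply/eqP; congr `|_|; ring.
Qed.

(** No change of variables is used: the integral of [m] over [[0, a + t]], as a function of [t], has
    the uniform derivative [m (a + t)]. *)
Lemma Rintegral_shift m (a t : R) : ucont m -> 0 <= a -> 0 <= t ->
  \int[lam]_(s in `[0, t]) m (a + s) = \int[lam]_(s in `[a, a + t]) m s.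
Proof.
move=> um a0 t0.
have at0 : a <= a + t by rewrite lerDl.
rewrite (@Rintegral_of_uniform_derivative
  (fun t => \int[lam]_(s in `[0, a + t]) m s)) //.
- by rewrite addr0 (@Rintegral_split m 0 a (a + t))// addrAC subrr add0r.
- move=> e e0; have [d d0 md] := um _ e0; exists d => // s h s0 h0 hd.
  by rewrite addrA md// addr_ge0.
- move=> e e0; have [d d0 md] := um _ e0; exists d => // s h s0 h0 hd.
  rewrite addrA (@Rintegral_split m 0 (a + s)) ?addr_ge0 ?lerDl//.
  have := Rintegral_modulus um md (addr_ge0 a0 s0) h0 hd; apply: le_trans.
  by rewrite le_eqVlt; apply/orP; left; apply/eqP; congr `|_|; ring.
Qed.

(* Euler scheme for F' <= - c F, with 1 - c h <= expR (- c h) at each step. *)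
Lemma discrete_gronwall F (c : R) : 0 <= c -> (forall s, 0 <= s -> 0 <= F s) ->
  (forall e, 0 < e -> exists2 d : R, 0 < d & forall s h : R, 0 <= s -> 0 <= h -> h <= d ->
    F (s + h) - F s <= e * h - c * h * F s) ->
  forall t, 0 <= t -> F t <= expR (- c * t) * F 0.
Proof.
move=> c0 F0 FP t t0; apply/ler_addgt0Pr => e e0.
pose e' := e / (t + 1).
have e'0 : 0 < e' by rewrite divr_gt0//; lra.
have [d d0 Fd] := FP _ e'0.
have [n /(_ n (leqnn _)) nP] := small_mesh t d0.
set h := t / n.+1%:R in nP.
have h0 : 0 <= h by rewrite divr_ge0.
(* The accumulated error grows only linearly, since every step multiplies the earlier errors by a
   factor at most 1. *)
suff H k : F (k%:R * h) <= expR (- c * (k%:R * h)) * F 0 + e' * (k%:R * h).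
  have := H n.+1; rewrite /h mulrCA divff ?mulr1 ?pnatr_eq0// => /le_trans; apply.
  rewrite lerD2l /e' mulrAC -mulrA ler_piMr ?(ltW e0)//.
  by rewrite ler_pdivrMr ?mul1r; lra.
elim: k => [|k IH]; first by rewrite !mul0r !mulr0 expR0 mul1r addr0.
have kh0 : 0 <= k%:R * h by rewrite mulr_ge0.
have := Fd (k%:R * h) h kh0 h0 nP.
have kS : k%:R * h + h = k.+1%:R * h by rewrite -natr1 mulrDl mul1r.
rewrite kS lerBlDr => /le_trans; apply.
have ch : 1 - c * h <= expR (- c * h).
  by have := expR_ge1Dx (- c * h); rewrite mulNr.
have e1 : expR (- c * h) <= 1 by rewrite -expR0 ler_expR mulNr oppr_le0 mulr_ge0.
rewrite -kS mulrDr expRD mulrDr.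
have F1 : F (k%:R * h) * (1 - c * h) <= F (k%:R * h) * expR (- c * h).
  by rewrite ler_wpM2l// F0.
have F2 : F (k%:R * h) * expR (- c * h) <=
    (expR (- c * (k%:R * h)) * F 0 + e' * (k%:R * h)) * expR (- c * h).
  by rewrite ler_wpM2r// expR_ge0.
have F3 : e' * (k%:R * h) * expR (- c * h) <= e' * (k%:R * h).
  by rewrite ler_piMr// mulr_ge0// ltW.
nra.
Qed.

End uniform_modulus.

(** * Contraction semigroups on a pre-Hilbert space *)

Section contraction_semigroup.
Context {R : realType} {H : lmodType R} (ip : H -> H -> R).
Hypothesis ipC : forall x y, ip x y = ip y x.
Hypothesis ip_linear : forall a x y z, ip (a *: x + y) z = a * ip x z + ip y z.
Hypothesis ip_ge0 : forall x, 0 <= ip x x.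
Implicit Types (x y z f g : H) (s t h e : R).
Local Notation lam := (@lebesgue_measure R).

(** Only a seminorm, as [ip] is not assumed definite: the theory is applied to functions rather than
    to their classes modulo almost everywhere equality. *)
Definition nm x := Num.sqrt (ip x x).

Lemma ip0l z : ip 0 z = 0.
Proof. by have := ip_linear 1 0 0 z; rewrite scaler0 addr0; lra. Qed.

Lemma ipZl a x z : ip (a *: x) z = a * ip x z.
Proof. by rewrite -[a *: x]addr0 ip_linear ip0l addr0. Qed.

Lemma ipDl x y z : ip (x + y) z = ip x z + ip y z.
Proof. by rewrite -[x in LHS]scale1r ip_linear mul1r. Qed.

Lemma ipBl x y z : ip (x - y) z = ip x z - ip y z.
Proof. by rewrite ipDl -scaleN1r ipZl mulN1r. Qed.

Lemma ipZr a x z : ip z (a *: x) = a * ip z x.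
Proof. by rewrite ipC ipZl ipC. Qed.

Lemma ipDr x y z : ip z (x + y) = ip z x + ip z y.
Proof. by rewrite ipC ipDl !(ipC _ z). Qed.

Lemma ipBr x y z : ip z (x - y) = ip z x - ip z y.
Proof. by rewrite ipC ipBl !(ipC _ z). Qed.

Lemma nm_ge0 x : 0 <= nm x. Proof. exact: sqrtr_ge0. Qed.

Lemma sqr_nm x : nm x ^+ 2 = ip x x. Proof. by rewrite sqr_sqrtr. Qed.

Lemma nm_leP x e : 0 <= e -> (nm x <= e) = (ip x x <= e ^+ 2).
Proof. by move=> e0; rewrite -sqr_nm ler_pXn2r ?nnegrE ?nm_ge0. Qed.

Lemma cauchy_schwarz x y : `|ip x y| <= nm x * nm y.
Proof.
rewrite -[leLHS]sqrtr_sqr /nm -sqrtrM// ler_wsqrtr//.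
have Q a : 0 <= ip x x + 2 * a * ip x y + a ^+ 2 * ip y y.
  have := ip_ge0 (x + a *: y).
  by rewrite !(ipDl, ipDr, ipZl, ipZr) (ipC y x); congr (0 <= _); ring.
have [y0|y0] := eqVneq (ip y y) 0.
  rewrite y0 mulr0; have [-> |xy0] := eqVneq (ip x y) 0; first by rewrite expr0n.
  (* For a null vector [y] the quadratic is affine in its parameter, and this value of the parameter
     would make it equal to -1. *)
  have := Q (- (ip x x + 1) / (2 * ip x y)); rewrite y0 mulr0 addr0.
  by rewrite (_ : _ + _ = -1); [lra|field].
have yp : 0 < ip y y by rewrite lt_neqAle eq_sym y0 ip_ge0.
(* The minimiser of the quadratic. *)
have := mulr_ge0 (Q (- ip x y / ip y y)) (ltW yp).
rewrite (_ : (_ + _) * _ = ip x x * ip y y - ip x y ^+ 2); first by rewrite subr_ge0.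
by field; rewrite gt_eqF.
Qed.

Lemma nmD x y : nm (x + y) <= nm x + nm y.
Proof.
rewrite nm_leP ?addr_ge0 ?nm_ge0// sqrrD !sqr_nm !(ipDl, ipDr) (ipC y x).
have := le_trans (ler_norm _) (cauchy_schwarz x y).
by rewrite mulr2n; lra.
Qed.

Lemma nmZ a x : nm (a *: x) = `|a| * nm x.
Proof.
by rewrite /nm ipZl ipZr mulrA -expr2 sqrtrM ?sqr_ge0// sqrtr_sqr.
Qed.

Lemma nmN x : nm (- x) = nm x.
Proof. by rewrite -scaleN1r nmZ normrN1 mul1r. Qed.

Lemma nmB x y : nm (x - y) <= nm x + nm y.
Proof. by rewrite (le_trans (nmD _ _))// nmN. Qed.

(* The dual description of the seminorm: elements are only handled through
   their inner products, so that no quotient by null vectors is needed. *)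
Lemma nm_le_dual x e : 0 <= e -> (forall z, `|ip x z| <= e * nm z) -> nm x <= e.
Proof.
move=> e0 /(_ x); rewrite ger0_norm// -sqr_nm expr2.
have := nm_ge0 x; rewrite le_eqVlt => /predU1P[<- //|x0].
by rewrite ler_pM2r.
Qed.

Lemma eq_ip_nm x y : (forall z, ip x z = ip y z) -> nm x = nm y.
Proof. by move=> xy; rewrite /nm xy ipC xy. Qed.

Lemma nm0_ip x z : nm x = 0 -> ip x z = 0.
Proof.
move=> x0; apply/eqP; rewrite -normr_le0.
by rewrite (le_trans (cauchy_schwarz _ _))// x0 mul0r.
Qed.

Hypothesis complete : forall u : nat -> H,
  (forall e, 0 < e -> exists n0, forall m n, (n0 <= m)%N -> (n0 <= n)%N ->
    nm (u m - u n) <= e) ->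
  exists x, forall e, 0 < e -> exists n0, forall n, (n0 <= n)%N -> nm (u n - x) <= e.

Variable P : R -> H -> H.
(** This law and the two that follow are tested against every [z], because transition operators
    satisfy them in general only almost everywhere. *)
Hypothesis P_linear : forall t a x y z, 0 <= t ->
  ip (P t (a *: x + y)) z = a * ip (P t x) z + ip (P t y) z.
Hypothesis P_comp : forall s t x z, 0 <= s -> 0 <= t ->
  ip (P s (P t x)) z = ip (P (s + t) x) z.
Hypothesis P_0 : forall x z, ip (P 0 x) z = ip x z.
Hypothesis P_contr : forall t x, 0 <= t -> nm (P t x) <= nm x.
Hypothesis P_cont : forall x e, 0 < e -> exists2 d : R, 0 < d &
  forall h, 0 < h -> h <= d -> nm (P h x - x) <= e.

(** * Uniform continuity of orbits and their weak integrals *)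

Lemma P0l t z : 0 <= t -> ip (P t 0) z = 0.
Proof. by move=> t0; have := P_linear 1 0 0 z t0; rewrite scaler0 addr0; lra. Qed.

Lemma PZl t a x z : 0 <= t -> ip (P t (a *: x)) z = a * ip (P t x) z.
Proof. by move=> t0; rewrite -[a *: x]addr0 P_linear// P0l// addr0. Qed.

Lemma PDl t x y z : 0 <= t -> ip (P t (x + y)) z = ip (P t x) z + ip (P t y) z.
Proof. by move=> t0; rewrite -[x in LHS]scale1r P_linear// mul1r. Qed.

Lemma PBl t x y z : 0 <= t -> ip (P t (x - y)) z = ip (P t x) z - ip (P t y) z.
Proof. by move=> t0; rewrite PDl// -scaleN1r PZl// mulN1r. Qed.

Lemma P_suml t (n : nat) (F : 'I_n -> H) z : 0 <= t ->
  ip (P t (\sum_(i < n) F i)) z = \sum_(i < n) ip (P t (F i)) z.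
Proof.
move=> t0; elim: n F => [|n IH] F; first by rewrite !big_ord0 P0l.
by rewrite !big_ord_recr/= PDl// IH.
Qed.

Lemma nm_PB t x y : 0 <= t -> nm (P t x - P t y) <= nm (x - y).
Proof.
move=> t0; rewrite (@eq_ip_nm _ (P t (x - y))) ?P_contr// => z.
by rewrite ipBl PBl.
Qed.

(** The semigroup law and contractivity turn continuity at 0 into continuity uniform on the
    half-line; the moduli of continuity of orbits come from here. *)
Lemma nm_Pincr s h x : 0 <= s -> 0 <= h -> nm (P (s + h) x - P s x) <= nm (P h x - x).
Proof.
move=> s0 h0; rewrite (le_trans _ (nm_PB _ _ s0))// le_eqVlt; apply/orP; left.
by apply/eqP/eq_ip_nm => z; rewrite !ipBl P_comp.
Qed.

Lemma P_cont0 x e : 0 < e -> exists2 d : R, 0 < d &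
  forall h, 0 <= h -> h <= d -> nm (P h x - x) <= e.
Proof.
move=> e0; have [d d0 dP] := P_cont x e0; exists d => // h.
rewrite le_eqVlt => /predU1P[<- _|]; last exact: dP.
rewrite (@eq_ip_nm _ 0) => [|z]; last by rewrite ipBl P_0 subrr ip0l.
by rewrite /nm ip0l sqrtr0 ltW.
Qed.

Lemma modulus_ipP x e d z s : 0 <= s ->
  (forall h, 0 <= h -> h <= d -> nm (P h x - x) <= e) ->
  modulus (fun u => ip (P (s + u) x) z) (e * nm z) d.
Proof.
move=> s0 xd u h u0 h0 hd; rewrite -ipBl (le_trans (cauchy_schwarz _ _))//.
rewrite ler_wpM2r ?nm_ge0// addrA (le_trans (nm_Pincr _ _ _)) ?addr_ge0//.
exact: xd.
Qed.

Lemma ucont_ipP x z s : 0 <= s -> ucont (fun u => ip (P (s + u) x) z).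
Proof.
move=> s0 e e0; have e'0 : 0 < e / (nm z + 1).
  by rewrite divr_gt0// ltr_wpDl// nm_ge0.
have [d d0 dP] := P_cont0 x e'0; exists d => // u h u0 h0 hd.
have := modulus_ipP z s0 dP u0 h0 hd => /le_trans; apply.
rewrite mulrAC -mulrA ler_piMr ?(ltW e0)// ler_pdivrMr.
  by rewrite mul1r lerDl.
by rewrite ltr_wpDl// nm_ge0.
Qed.

Lemma ucont_ipP2 x y : ucont (fun u => ip (P u x) (P u y)).
Proof.
move=> e e0; pose c := nm x + nm y + 1.
have c0 : 0 < c by rewrite ltr_wpDl// addr_ge0 ?nm_ge0.
have e'0 : 0 < e / c by rewrite divr_gt0.
have [d1 d10 xd] := P_cont0 x e'0; have [d2 d20 yd] := P_cont0 y e'0.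
exists (Num.min d1 d2) => [|s h s0 h0]; first by rewrite lt_min d10.
rewrite le_min => /andP[hd1 hd2].
have -> : ip (P (s + h) x) (P (s + h) y) - ip (P s x) (P s y) =
    ip (P (s + h) x - P s x) (P (s + h) y) + ip (P s x) (P (s + h) y - P s y).
  by rewrite ipBl ipBr; ring.
rewrite (le_trans (ler_normD _ _))//.
have X : `|ip (P (s + h) x - P s x) (P (s + h) y)| <= e / c * nm y.
  rewrite (le_trans (cauchy_schwarz _ _))// ler_pM ?nm_ge0//; last first.
    by rewrite P_contr// addr_ge0.
  by rewrite (le_trans (nm_Pincr _ _ _))// xd.
have Y : `|ip (P s x) (P (s + h) y - P s y)| <= nm x * (e / c).
  rewrite (le_trans (cauchy_schwarz _ _))// ler_pM ?nm_ge0 ?P_contr//.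
  by rewrite (le_trans (nm_Pincr _ _ _))// yd.
rewrite (le_trans (lerD X Y))// mulrC -mulrDl mulrCA ler_piMr ?(ltW e0)//.
by rewrite ler_pdivrMr// mul1r /c; lra.
Qed.

(* [g] is the vector-valued integral of [P u f] over [u] in [0, t]. *)
Lemma exists_weak_integral f t : 0 <= t -> exists g, forall s z, 0 <= s ->
  ip (P s g) z = \int[lam]_(u in `[0, t]) ip (P (s + u) f) z.
Proof.
move=> t0.
pose r n := \sum_(k < n.+1) (t / n.+1%:R) *: P (k%:R * (t / n.+1%:R)) f.
have rE n s z : 0 <= s -> ip (P s (r n)) z =
    \sum_(k < n.+1) t / n.+1%:R * ip (P (s + k%:R * (t / n.+1%:R)) f) z.
  move=> s0; rewrite /r P_suml//; apply: eq_bigr => k _.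
  by rewrite PZl// P_comp// mulr_ge0// divr_ge0.
(* The rate is uniform in [s] and in [z] up to [nm z]: at [s = 0], duality turns it into a Cauchy
   bound in norm. *)
have rP e : 0 < e -> exists n0, forall n s z, (n0 <= n)%N -> 0 <= s ->
    `|\int[lam]_(u in `[0, t]) ip (P (s + u) f) z - ip (P s (r n)) z| <= e * nm z.
  move=> e0; pose e' := e / (t + 1).
  have e'0 : 0 < e' by rewrite divr_gt0//; lra.
  have [d d0 dP] := P_cont0 f e'0; have [n0 n0P] := small_mesh t d0.
  exists n0 => n s z n0n s0; rewrite rE//.
  have := Riemann_sum_modulus (ucont_ipP f z s0) (modulus_ipP z s0 dP) t0 (n0P n n0n).
  move=> /le_trans; apply; rewrite mulrAC ler_wpM2r ?nm_ge0//.
  by rewrite /e' mulrAC -mulrA ler_piMr ?(ltW e0)// ler_pdivrMr ?mul1r; lra.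
have [g gP] : exists x, forall e, 0 < e ->
    exists n0, forall n, (n0 <= n)%N -> nm (r n - x) <= e.
  apply: complete => e e0; have e20 : 0 < e / 2 by rewrite divr_gt0.
  have [n0 n0P] := rP _ e20; exists n0 => m n n0m n0n.
  apply: nm_le_dual => [|z]; first exact: ltW.
  have A := n0P m 0 z n0m (lexx _); have B := n0P n 0 z n0n (lexx _).
  rewrite !P_0 in A B; rewrite ipBl [e]splitr mulrDl (le_trans _ (lerD B A))//.
  rewrite (le_trans _ (ler_normB _ _))//.
  by rewrite le_eqVlt; apply/orP; left; apply/eqP; congr `|_|; ring.
exists g => s z s0; apply/eqP; rewrite -subr_eq0 -normr_le0.
apply/ler_addgt0Pr => e e0; rewrite add0r.
pose e' := e / (2 * (nm z + 1)).
have z1 : 0 < nm z + 1 by rewrite ltr_wpDl ?nm_ge0.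
have e'0 : 0 < e' by rewrite divr_gt0// mulr_gt0.
have [n1 n1P] := rP _ e'0; have [n2 n2P] := gP _ e'0.
pose n := maxn n1 n2.
have A := n1P n s z (leq_maxl _ _) s0.
have B : `|ip (P s (r n)) z - ip (P s g) z| <= e' * nm z.
  rewrite -ipBl (le_trans (cauchy_schwarz _ _))// ler_wpM2r ?nm_ge0//.
  by rewrite (le_trans (nm_PB _ _ s0))// n2P// leq_maxr.
rewrite distrC (le_trans (ler_distD (ip (P s (r n)) z) _ _))//.
rewrite (le_trans (lerD A B))// -mulrDl.
have -> : (e' + e') * nm z = e * (nm z / (nm z + 1)) by rewrite /e'; field; lra.
by rewrite ler_piMr ?(ltW e0)// ler_pdivrMr// mul1r; lra.
Qed.

(** * The generator as a relation *)

Definition gen f g := forall e, 0 < e -> exists2 d : R, 0 < d &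
  forall h, 0 < h -> h <= d -> nm (h^-1 *: (P h f - f) - g) <= e.

Lemma gen_unique f g g' : gen f g -> gen f g' -> nm (g - g') = 0.
Proof.
move=> fg fg'; apply/eqP; rewrite eq_le nm_ge0 andbT.
apply/ler_addgt0Pr => e e0; rewrite add0r.
have e20 : 0 < e / 2 by rewrite divr_gt0.
have [d1 d10 A] := fg _ e20; have [d2 d20 B] := fg' _ e20.
pose h := Num.min d1 d2.
have h0 : 0 < h by rewrite lt_min d10.
have hd1 : h <= d1 by rewrite ge_min lexx.
have hd2 : h <= d2 by rewrite ge_min lexx orbT.
have := lerD (B h h0 hd2) (A h h0 hd1).
rewrite -splitr; apply: le_trans; apply: le_trans (nmB _ _).
by rewrite opprB [X in _ <= nm X]addrC subrKA.
Qed.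

Lemma genZ a f g : gen f g -> gen (a *: f) (a *: g).
Proof.
move=> fg e e0; have a1 : 0 < `|a| + 1 by rewrite ltr_wpDl.
have [d d0 dP] := fg _ (divr_gt0 e0 a1); exists d => // h h0 hd.
rewrite (@eq_ip_nm _ (a *: (h^-1 *: (P h f - f) - g))); last first.
  by move=> z; rewrite !(ipBl, ipZl) PZl ?ltW//; ring.
rewrite nmZ (le_trans (ler_wpM2l _ (dP h h0 hd)))// mulrCA ler_piMr ?(ltW e0)//.
by rewrite ler_pdivrMr// mul1r; lra.
Qed.

(** [P s] commutes with difference quotients and contracts their errors. The domain is therefore
    invariant, so the inequality (i) can be used along the whole orbit. *)
Lemma gen_P f g s : 0 <= s -> gen f g -> gen (P s f) (P s g).
Proof.
move=> s0 fg e e0; have [d d0 dP] := fg _ e0; exists d => // h h0 hd.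
rewrite (@eq_ip_nm _ (P s (h^-1 *: (P h f - f) - g))); last first.
  move=> z; rewrite !(ipBl, ipZl) PBl// PZl// PBl// !P_comp ?(ltW h0)//.
  by rewrite (addrC h).
by rewrite (le_trans (P_contr _ s0))// dP.
Qed.

(** In [P h g - g] the integrals over [[h, t + h]] and [[0, t]] differ only by the end pieces
    [[t, t + h]] and [[0, h]], which are close to [h] times [P t f] and [f]. The bounds are
    proportional to [nm z], so duality applies. *)
Lemma gen_weak_integral f t g : 0 < t ->
  (forall s z, 0 <= s -> ip (P s g) z = \int[lam]_(u in `[0, t]) ip (P (s + u) f) z) ->
  gen g (P t f - f).
Proof.
move=> t0 gE e e0; have e20 : 0 < e / 2 by rewrite divr_gt0.
(* [h <= t] makes [[h, t]] common to both integrals; [h <= d] controls the end pieces. *)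
have [d d0 dP] := P_cont0 f e20; exists (Num.min d t) => [|h h0].
  by rewrite lt_min d0.
rewrite le_min => /andP[hd ht]; apply: nm_le_dual => [|z]; first exact: ltW.
have uf := ucont_ipP f z (lexx 0).
have mf := modulus_ipP z (lexx 0) dP.
pose m u := ip (P (0 + u) f) z.
have um : ucont m by exact: ucont_ipP.
have m0 : m 0 = ip f z by rewrite /m addr0 P_0.
have mt : m t = ip (P t f) z by rewrite /m add0r.
have shift : \int[lam]_(u in `[0, t]) ip (P (h + u) f) z =
    \int[lam]_(u in `[h, t + h]) m u.
  rewrite (addrC t) -(Rintegral_shift um (ltW h0) (ltW t0)).
  by apply: eq_Rintegral => u _; rewrite /m add0r.
rewrite !(ipBl, ipZl) gE ?(ltW h0)// shift.
have -> : ip g z = \int[lam]_(u in `[0, t]) m u by rewrite -P_0 gE.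
rewrite (@Rintegral_split _ m h t (t + h)) ?lerDl ?(ltW h0)//.
rewrite (@Rintegral_split _ m 0 h t) ?(ltW h0)// -mt -m0.
have A := Rintegral_modulus um mf (lexx 0) (ltW h0) hd.
have B := Rintegral_modulus um mf (ltW t0) (ltW h0) hd.
rewrite add0r in A; rewrite -(ler_pM2l h0).
have -> : h * (e * nm z) = e / 2 * nm z * h + e / 2 * nm z * h by field.
rewrite (le_trans _ (lerD A B))// -[X in X * `|_|](ger0_norm (ltW h0)) -normrM.
rewrite -[X in _ <= X + _]normrN (le_trans _ (ler_normD _ _))//.
rewrite le_eqVlt; apply/orP; left; apply/eqP; congr `|_|; field; lra.
Qed.

(** The last clause will be used with [z] the constant function 1: averaging along the orbit
    preserves mean zero. *)
Lemma gen_dense f e : 0 < e -> exists g, [/\ exists g', gen g g', nm (g - f) <= e &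
  forall z, (forall t, 0 <= t -> ip (P t f) z = 0) -> ip g z = 0].
Proof.
move=> e0; have [d d0 dP] := P_cont0 f e0.
have [g gE] := exists_weak_integral f (ltW d0).
exists (d^-1 *: g); split.
- by exists (d^-1 *: (P d f - f)); apply: genZ; exact: gen_weak_integral.
- apply: nm_le_dual => [|z]; first exact: ltW.
  rewrite ipBl ipZl -(P_0 g) gE// -(ler_pM2l d0).
  rewrite -[X in X * `|_|](ger0_norm (ltW d0)) -normrM mulrBr mulVKf ?gt_eqF//.
  have := Rintegral_modulus (ucont_ipP f z (lexx 0)) (modulus_ipP z (lexx 0) dP)
    (lexx 0) (ltW d0) (lexx d).
  by rewrite !add0r P_0 (mulrC _ d).
- move=> z fz; rewrite ipZl -(P_0 g) gE//.
  rewrite (@eq_Rintegral _ _ _ _ _ (cst 0)) => [|u]; last first.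
    by rewrite inE/= in_itv/= => /andP[u0 _]; rewrite add0r fz.
  by rewrite Rintegral_itv_cst ?(ltW d0)// mul0r mulr0.
Qed.

(** * Energy along an orbit *)

Local Notation N f := (fun s => ip (P s f) (P s f)).

(** Write [P h f = f + h (g + r)] with [r] small, apply [P s] and expand the square. The errors are
    a first-order term in [r] and a second-order term in [h]. *)
Lemma N_increment f g e : gen f g -> 0 < e -> exists2 d : R, 0 < d &
  forall s h, 0 <= s -> 0 <= h -> h <= d ->
  `|N f (s + h) - N f s - h * (2 * ip (P s f) (P s g))| <= e * h.
Proof.
move=> fg e0; pose c := nm f + nm g + 1.
have c0 : 0 < c by rewrite ltr_wpDl// addr_ge0 ?nm_ge0.
(* [e' <= 1] gives [nm (g + r) <= c], and [4 * c] bounds the first-order error by [e / 2]; the bound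
   on [h] below leaves [e / 2] for the second-order one. *)
pose e' := Num.min 1 (e / (4 * c)).
have e'0 : 0 < e' by rewrite lt_min ltr01 divr_gt0// mulr_gt0.
have e'1 : e' <= 1 by rewrite ge_min lexx.
have e'e : e' * (4 * c) <= e by rewrite -ler_pdivlMr ?mulr_gt0// ge_min lexx orbT.
have [d d0 dP] := fg _ e'0.
exists (Num.min d (e / (2 * c ^+ 2))) => [|s h s0].
  by rewrite lt_min d0 divr_gt0// mulr_gt0// exprn_gt0.
rewrite le_eqVlt => /predU1P[<- _|h0].
  by rewrite addr0 subrr !mul0r subrr normr0 mulr0.
rewrite le_min => /andP[hd]; rewrite ler_pdivlMr ?mulr_gt0 ?exprn_gt0// => he.
pose r := h^-1 *: (P h f - f) - g.
have rP : nm r <= e' by exact: dP.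
have fE : P h f = f + h *: (g + r).
  by rewrite /r subrKC scalerA mulfV ?gt_eqF// scale1r subrKC.
have E z : ip (P (s + h) f) z = ip (P s f) z + h * ip (P s (g + r)) z.
  by rewrite -P_comp ?(ltW h0)// fE PDl// PZl.
have E' z : ip z (P (s + h) f) = ip z (P s f) + h * ip z (P s (g + r)).
  by rewrite ipC E !(ipC _ z).
have -> : N f (s + h) - N f s - h * (2 * ip (P s f) (P s g)) =
    h * (2 * ip (P s f) (P s r) + h * ip (P s (g + r)) (P s (g + r))).
  rewrite E !E' (ipC (P s (g + r)) (P s f)).
  have -> : ip (P s f) (P s (g + r)) = ip (P s f) (P s g) + ip (P s f) (P s r).
    by rewrite ipC PDl// !(ipC _ (P s f)).
  by ring.
rewrite normrM ger0_norm ?(ltW h0)// mulrC ler_wpM2r ?(ltW h0)//.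
have A : `|ip (P s f) (P s r)| <= c * e'.
  rewrite (le_trans (cauchy_schwarz _ _))// ler_pM ?nm_ge0//.
    by rewrite (le_trans (P_contr _ s0))// /c -addrA lerDl addr_ge0 ?nm_ge0.
  by rewrite (le_trans (P_contr _ s0)).
have B : ip (P s (g + r)) (P s (g + r)) <= c ^+ 2.
  rewrite -nm_leP ?(ltW c0)// (le_trans (P_contr _ s0))// (le_trans (nmD _ _))//.
  by have := nm_ge0 f; rewrite /c; lra.
have B0 : 0 <= ip (P s (g + r)) (P s (g + r)) by [].
rewrite (le_trans (ler_normD _ _))// !normrM (ger0_norm (ltW h0)) (ger0_norm B0) ger0_norm//.
have hB := ler_wpM2l (ltW h0) B; lra.
Qed.

Lemma N_ftc f g t : gen f g -> 0 <= t ->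
  \int[lam]_(s in `[0, t]) (2 * ip (P s f) (P s g)) = N f t - ip f f.
Proof.
move=> fg t0; rewrite (@Rintegral_of_uniform_derivative _ (N f)) //.
- by rewrite P_0 ipC P_0.
- move=> e e0; have e20 : 0 < e / 2 by rewrite divr_gt0.
  have [d d0 dP] := @ucont_ipP2 f g _ e20; exists d => // s h s0 h0 hd.
  rewrite -mulrBr normrM ger0_norm// mulrC -ler_pdivlMr//.
  exact: dP.
- by move=> e; exact: N_increment.
Qed.

Lemma N_nincr f s t : 0 <= s -> s <= t -> N f t <= N f s.
Proof.
move=> s0 st; have ts0 : 0 <= t - s by rewrite subr_ge0.
rewrite -!sqr_nm ler_pXn2r ?nnegrE ?nm_ge0//.
rewrite -(subrK s t) (@eq_ip_nm _ (P (t - s) (P s f))) ?P_contr// => z.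
by rewrite P_comp.
Qed.

(** The dissipation integral becomes a boundary term that no longer mentions the generator. *)
Lemma energy_identity f g t : gen f g -> 0 <= t ->
  \int[lam]_(s in `[0, t]) ip (P s f) (- P s g) = (ip f f - N f t) / 2.
Proof.
move=> fg t0.
have E s : ip (P s f) (- P s g) = - 2^-1 * (2 * ip (P s f) (P s g)).
  by rewrite -scaleN1r ipZr mulN1r; field.
under eq_Rintegral do rewrite E.
rewrite RintegralZl//; first by rewrite (N_ftc fg t0); lra.
apply: ucont_integrable => //.
move=> e e0; have e20 : 0 < e / 2 by rewrite divr_gt0.
have [d d0 dP] := @ucont_ipP2 f g _ e20; exists d => // s h s0 h0 hd.
rewrite -mulrBr normrM ger0_norm// mulrC -ler_pdivlMr//.
exact: dP.
Qed.

(** * Energy integrals over sliding windows of length [T] *)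

Variables (nu T : R).
Hypotheses (nu0 : 0 < nu) (T0 : 0 < T).
Local Notation I f t := (\int[lam]_(s in `[t, t + T]) N f s).

Lemma I0E f : I f 0 = \int[lam]_(s in `[0, T]) N f s.
Proof. by rewrite add0r. Qed.

Lemma I_ge0 f t : 0 <= I f t. Proof. exact: Rintegral_ge0. Qed.

Lemma I_P f s : 0 <= s -> I (P s f) 0 = I f s.
Proof.
move=> s0; rewrite I0E -(Rintegral_shift (@ucont_ipP2 f f) s0 (ltW T0)).
apply: eq_Rintegral => u; rewrite inE/= in_itv/= => /andP[u0 _].
by rewrite -!sqr_nm (@eq_ip_nm _ (P (s + u) f))// => z; rewrite P_comp// addrC.
Qed.

(** Sliding the window by [h] adds a piece at [s + T] and removes one at [s], so the derivative is
    [N f (s + T) - N f s]. *)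
Lemma I_increment f e : 0 < e -> exists2 d : R, 0 < d &
  forall s h, 0 <= s -> 0 <= h -> h <= d ->
  `|I f (s + h) - I f s - h * (N f (s + T) - N f s)| <= e * h.
Proof.
move=> e0; have e20 : 0 < e / 2 by rewrite divr_gt0.
have u := @ucont_ipP2 f f; have [d d0 dP] := u _ e20.
exists d => // s h s0 h0 hd.
have sT : s <= s + T by rewrite lerDl ltW.
have A := Rintegral_modulus u dP s0 h0 hd.
have B := Rintegral_modulus u dP (addr_ge0 s0 (ltW T0)) h0 hd.
have sh : s <= s + h by rewrite lerDl.
have shT : s + h <= s + h + T by rewrite lerDl ltW.
have sTh : s + T <= s + h + T by rewrite lerD2r.
have E : I f (s + h) - I f s =
    \int[lam]_(v in `[s + T, s + T + h]) N f v - \int[lam]_(v in `[s, s + h]) N f v.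
  have := Rintegral_split u s0 sh shT; rewrite (Rintegral_split u s0 sT sTh).
  by rewrite (addrAC s T h); lra.
have -> : e * h = e / 2 * h + e / 2 * h by field.
rewrite E (le_trans _ (lerD B A))// (le_trans _ (ler_normB _ _))//.
by rewrite le_eqVlt; apply/orP; left; apply/eqP; congr `|_|; ring.
Qed.

(** Polarise [N g - N f] and use contractivity. The constant does not depend on [t], and [e <= 1]
    bounds [nm g] by [nm f + 1]. *)
Lemma I_perturb f g e t : 0 <= t -> 0 <= e -> e <= 1 -> nm (g - f) <= e ->
  `|I g t - I f t| <= T * (2 * nm f + 1) * e.
Proof.
move=> t0 e0 e1 gf.
have tT : t <= t + T by rewrite lerDl ltW.
have ig := ucont_integrable (t + T) (@ucont_ipP2 g g) t0.
have jf := ucont_integrable (t + T) (@ucont_ipP2 f f) t0.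
rewrite -RintegralB//.
have id : lam.-integrable `[t, t + T] (EFin \o (fun s => N g s - N f s)).
  exact: (integrableB _ ig jf).
rewrite (le_trans (le_normr_Rintegral _ id))//.
have -> : T * (2 * nm f + 1) * e = \int[lam]_(u in `[t, t + T]) ((2 * nm f + 1) * e).
  by rewrite Rintegral_itv_cst// addrAC subrr add0r; ring.
apply: le_Rintegral => //.
- exact: (integrable_norm id).
- apply: continuous_compact_integrable; first exact: segment_compact.
  by apply: continuous_subspaceT => x; exact: cvg_cst.
move=> s /=; rewrite in_itv/= => /andP[ts _]; have s0 := le_trans t0 ts.
have -> : N g s - N f s = ip (P s g - P s f) (P s g) + ip (P s g - P s f) (P s f).
  by rewrite !ipBl (ipC (P s g) (P s f)); ring.
have ge : nm g <= nm f + e.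
  by rewrite -[g in leLHS](subrKC f) (le_trans (nmD _ _))// lerD2l.
have D := le_trans (nm_PB g f s0) gf.
rewrite (le_trans (ler_normD _ _))//.
have A : `|ip (P s g - P s f) (P s g)| <= e * (nm f + 1).
  rewrite (le_trans (cauchy_schwarz _ _))// ler_pM ?nm_ge0//.
  by rewrite (le_trans (P_contr _ s0))// (le_trans ge)// lerD2l.
have B : `|ip (P s g - P s f) (P s f)| <= e * nm f.
  by rewrite (le_trans (cauchy_schwarz _ _))// ler_pM ?nm_ge0// P_contr.
lra.
Qed.

(** The flow Poincaré inequality rewritten by [energy_identity]; in this form it makes sense outside
    the domain of the generator too. *)
Definition poincare f := I f 0 <= nu^-1 * ((ip f f - N f T) / 2).

Lemma poincareP f : poincare f <-> N f T - ip f f <= - (2 * nu) * I f 0.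
Proof.
rewrite /poincare ler_pdivlMl//.
by split; lra.
Qed.

Lemma gronwall_domain f : (forall s, 0 <= s -> poincare (P s f)) ->
  forall t, 0 <= t -> I f t <= expR (- (2 * nu) * t) * I f 0.
Proof.
move=> fP; apply: discrete_gronwall.
- by rewrite mulr_ge0// ltW.
- by move=> s _; exact: I_ge0.
move=> e e0; have [d d0 dP] := I_increment f e0; exists d => // s h s0 h0 hd.
have := dP s h s0 h0 hd; rewrite ler_norml => /andP[_].
have := (poincareP _).1 (fP s s0); rewrite I_P//.
have -> : N (P s f) T = N f (s + T).
  by rewrite -!sqr_nm (@eq_ip_nm _ (P (s + T) f))// => z; rewrite P_comp ?(ltW T0)// addrC.
move=> A B; have := ler_wpM2l h0 A; lra.
Qed.

(** To be instantiated by the constant function 1: pairing with it is the mean, which invariance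
    conserves. *)
Variable one : H.
Hypothesis P_one : forall t f, 0 <= t -> ip (P t f) one = ip f one.

Lemma flow_poincare_decay :
  (forall f, ip f one = 0 -> (exists g, gen f g) -> poincare f) ->
  forall f t, ip f one = 0 -> 0 <= t -> I f t <= expR (- (2 * nu) * t) * I f 0.
Proof.
move=> i f t f1 t0; apply/ler_addgt0Pr => eta eta0.
pose c := T * (2 * nm f + 1).
have c0 : 0 < c by rewrite mulr_gt0// ltr_wpDl// mulr_ge0// nm_ge0.
(* Passing from [f] to [g] costs [c * e <= eta / 2] at time 0 and again at time [t]. *)
pose e := Num.min 1 (eta / (2 * c)).
have e0 : 0 < e by rewrite lt_min ltr01 divr_gt0// mulr_gt0.
have e1 : e <= 1 by rewrite ge_min lexx.
have c20 : 0 < 2 * c by rewrite mulr_gt0.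
have ec : e * (2 * c) <= eta by rewrite -(ler_pdivlMr _ _ c20) ge_min lexx orbT.
have [g [[g' gg'] gf g1]] := gen_dense f e0.
have : I g t <= expR (- (2 * nu) * t) * I g 0.
  apply: gronwall_domain t0 => s s0; apply: i; last by exists (P s g'); exact: gen_P.
  by rewrite P_one// g1// => u u0; rewrite P_one.
have E1 : expR (- (2 * nu) * t) <= 1.
  by rewrite -expR0 ler_expR mulNr oppr_le0 !mulr_ge0// ltW.
have := I_perturb t0 (ltW e0) e1 gf; have := I_perturb (lexx 0) (ltW e0) e1 gf.
rewrite -/c !ler_norml => /andP[_ A] /andP[B _] D.
have := ler_wpM2l (expR_ge0 (- (2 * nu) * t)) A.
have : expR (- (2 * nu) * t) * (c * e) <= c * e.
  by rewrite ler_piMl// mulr_ge0// ltW.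
lra.
Qed.

(** Both sides of the decay agree at time 0. Comparing their increments over a short time [h] and
    dividing by [h] gives the boundary form of the inequality, for arbitrary [f]. *)
Lemma decay_flow_poincare f :
  (forall t, 0 <= t -> I f t <= expR (- (2 * nu) * t) * I f 0) -> poincare f.
Proof.
move=> fP; apply/poincareP; apply/ler_addgt0Pr => eta eta0.
(* The coefficient of [h ^+ 2] left by expanding the exponential, plus 1 to make it positive; this
   remainder and the increment error each get [eta / 2]. *)
pose c := (2 * nu) ^+ 2 * I f 0 + 1.
have c0 : 0 < c by rewrite ltr_wpDl// mulr_ge0 ?sqr_ge0 ?I_ge0.
have eta20 : 0 < eta / 2 by rewrite divr_gt0.
have [d d0 dP] := I_increment f eta20.
pose h := Num.min d (eta / (2 * c)).
have h0 : 0 < h by rewrite lt_min d0 divr_gt0// mulr_gt0.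
have hd : h <= d by rewrite ge_min lexx.
have c20 : 0 < 2 * c by rewrite mulr_gt0.
have hc : h * (2 * c) <= eta by rewrite -(ler_pdivlMr _ _ c20) ge_min lexx orbT.
have := dP 0 h (lexx _) (ltW h0) hd; rewrite ler_norml => /andP[A _].
have B := fP h (ltW h0).
have x0 : 0 < 2 * nu * h by rewrite !mulr_gt0.
(* With [x = 2 * nu * h]: [expR (- x) <= (1 + x)^-1 <= 1 - x + x ^+ 2]. *)
have E : expR (- (2 * nu) * h) <= 1 - 2 * nu * h + (2 * nu * h) ^+ 2.
  rewrite mulNr expRN; set x := 2 * nu * h in x0 *.
  have x1 : 0 < 1 + x by lra.
  rewrite (@le_trans _ _ (1 + x)^-1)//.
    by rewrite lef_pV2 ?posrE ?expR_gt0// expR_ge1Dx.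
  rewrite -div1r ler_pdivrMr//.
  have -> : (1 - x + x ^+ 2) * (1 + x) = 1 + x ^+ 3 by ring.
  by rewrite lerDl exprn_ge0// ltW.
have D := ler_wpM2r (I_ge0 f 0) E.
have P0 : N f 0 = ip f f by rewrite P_0 ipC P_0.
rewrite P0 in A; rewrite -(ler_pM2l h0).
have F : (2 * nu * h) ^+ 2 * I f 0 <= h * (eta / 2).
  have -> : (2 * nu * h) ^+ 2 * I f 0 = h * (h * (c - 1)) by rewrite /c; ring.
  by rewrite ler_wpM2l ?(ltW h0)//; nra.
rewrite !add0r in A B D F *; lra.
Qed.

Lemma decay_norm f :
  (forall t, 0 <= t -> I f t <= expR (- (2 * nu) * t) * I f 0) ->
  forall t, 0 <= t -> nm (P t f) <= expR (nu * T) * expR (- nu * t) * nm f.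
Proof.
move=> fP t t0.
have lower s : 0 <= s -> T * N f (s + T) <= I f s.
  move=> s0.
  have -> : T * N f (s + T) = \int[lam]_(u in `[s, s + T]) N f (s + T).
    by rewrite Rintegral_itv_cst ?lerDl ?ltW// addrAC subrr add0r mulrC.
  apply: le_Rintegral => //.
  - apply: continuous_compact_integrable; first exact: segment_compact.
    by apply: continuous_subspaceT => x; exact: cvg_cst.
  - exact: ucont_integrable (@ucont_ipP2 f f) s0.
  by move=> u /=; rewrite in_itv/= => /andP[su usT]; apply: N_nincr => //; exact: le_trans su.
have upper : I f 0 <= T * ip f f.
  have -> : T * ip f f = \int[lam]_(u in `[0, 0 + T]) ip f f.
    by rewrite Rintegral_itv_cst ?add0r ?ltW// subr0 mulrC.
  apply: le_Rintegral => //.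
  - exact: ucont_integrable (@ucont_ipP2 f f) (lexx 0).
  - apply: continuous_compact_integrable; first exact: segment_compact.
    by apply: continuous_subspaceT => x; exact: cvg_cst.
  move=> u /=; rewrite in_itv/= => /andP[u0 _].
  by rewrite -!sqr_nm ler_pXn2r ?nnegrE ?nm_ge0// P_contr.
(* Up to time [T] the prefactor is at least 1 and contractivity suffices; afterwards the window that
   ends at [t] is used. *)
rewrite -expRD; have [tT|Tt] := leP t T.
  rewrite (le_trans (P_contr _ t0))// ler_peMl ?nm_ge0// -expR0 ler_expR mulNr.
  by rewrite -mulrBr mulr_ge0 ?subr_ge0// ltW.
have tT0 : 0 <= t - T by rewrite subr_ge0 ltW.
rewrite nm_leP ?mulr_ge0 ?expR_ge0 ?nm_ge0// exprMn sqr_nm -expRM_natl.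
rewrite -(ler_pM2l T0).
have := le_trans (lower _ tT0) (fP _ tT0); rewrite subrK => /le_trans; apply.
have -> : - (2 * nu) * (t - T) = 2 * (nu * T + - nu * t) by ring.
by rewrite mulrCA ler_wpM2l ?expR_ge0.
Qed.

End contraction_semigroup.

(** * The transition operators on L^2 *)

Section kernel_integral.
Context {d} {E : measurableType d} {R : realType}.
Local Open Scope ereal_scope.

Lemma integral_chapman_kolmogorov (k1 k2 k : R.-pker E ~> E) x (g : E -> \bar R) :
  (forall A, measurable A -> k x A = kcomp_noparam k1 k2 x A) ->
  (forall y, 0 <= g y) -> measurable_fun [set: E] g ->
  \int[k x]_y g y = \int[k1 x]_y \int[k2 y]_z g z.
Proof.
move=> kE g0 mg; rewrite -(integral_kcomp k1 (kernel.kernel_snd k2) x g0 mg).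
by apply: eq_measure_integral => A mA _; rewrite kE.
Qed.

(** Seen as a constant kernel, [mu] composes with [k], and invariance says that the composition is
    [mu] again. *)
Lemma integral_invariant (k : R.-pker E ~> E) (mu : probability E R) (g : E -> \bar R) :
  (forall A, measurable A -> \int[mu]_x k x A = mu A) ->
  (forall y, 0 <= g y) -> measurable_fun [set: E] g ->
  \int[mu]_y g y = \int[mu]_x \int[k x]_y g y.
Proof.
move=> muE g0 mg.
have mmu : measurable_fun [set: E] (fun _ : E => mu : pprobability E R).
  exact: measurable_cst.
have := integral_kcomp (kprobability mmu) (kernel.kernel_snd k) point g0 mg.
by move=> <-; apply: eq_measure_integral => A mA _; exact: (esym (muE _ mA)).
Qed.
End kernel_integral.

(** * Norm and inner product of square-integrable functions *)

Section L2_space.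
Context {d} {E : measurableType d} {R : realType} (mu : probability E R).
Implicit Types f g : E -> R.

Lemma powR2 (x : R) : `|x| `^ 2 = x * x.
Proof. by rewrite powR_mulrn// -normrX ger0_norm ?sqr_ge0// expr2. Qed.

(** True for every [f]: if the integral of the square is infinite, [fine] makes both sides 0. *)
Lemma L2norm_sqrt f : L2norm mu f = Num.sqrt (L2inner mu f f).
Proof.
rewrite /L2norm /L2inner /Rintegral unlock /Lnorm.
under eq_integral do rewrite /= powR2.
have : (0 <= \int[mu]_x (f x * f x)%:E)%E.
  by apply: integral_ge0 => x _; rewrite lee_fin -expr2 sqr_ge0.
case: (\int[mu]_x _)%E => [r| |]//.
- by rewrite lee_fin => r0 /=; rewrite powR12_sqrt.
- by move=> _; rewrite poweRyr//= sqrtr0.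
Qed.

Lemma L2P f : L2 mu f <->
  measurable_fun setT f /\ (\int[mu]_x (f x * f x)%:E < +oo)%E.
Proof.
rewrite /L2 /= inE; split.
  move=> /andP[]; rewrite !inE /= /finite_norm => mf ffin; split => //.
  have := poweR_lty 2 ffin; rewrite powR_Lnorm//.
  by under eq_integral do rewrite /= powR2.
move=> [mf ffin]; apply/andP; rewrite !inE /= /finite_norm; split => //.
rewrite unlock /Lnorm poweR_lty//.
by under eq_integral do rewrite /= powR2.
Qed.

Lemma L2_measurable f : L2 mu f -> measurable_fun setT f.
Proof. by case/L2P. Qed.

Lemma L2_integrableM f g : L2 mu f -> L2 mu g ->
  mu.-integrable setT (EFin \o (fun x => f x * g x)).
Proof. by move=> f2 g2; apply/Lfun1_integrable; exact: Lfun2_mul_Lfun1. Qed.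

Lemma L2_integrable f : L2 mu f -> mu.-integrable setT (EFin \o f).
Proof.
move=> f2; apply/Lfun1_integrable; apply: Lfun_subset12 => //.
exact: fin_num_measure.
Qed.

Lemma L2_cst (c : R) : L2 mu (cst c). Proof. exact: Lfun_cst. Qed.

Lemma L2inner_linear (a : R) f g h : L2 mu f -> L2 mu g -> L2 mu h ->
  L2inner mu (fun x => a * f x + g x) h = a * L2inner mu f h + L2inner mu g h.
Proof.
move=> f2 g2 h2; rewrite /L2inner.
under eq_Rintegral do rewrite mulrDl -mulrA.
have fh := L2_integrableM f2 h2; have gh := L2_integrableM g2 h2.
rewrite RintegralD//; first by rewrite RintegralZl.
exact: (integrableZl _ _ fh).
Qed.

Lemma L2inner_ge0 f : 0 <= L2inner mu f f.
Proof. by apply: Rintegral_ge0 => x _; rewrite -expr2 sqr_ge0. Qed.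

Lemma L2innerC f g : L2inner mu f g = L2inner mu g f.
Proof. by apply: eq_Rintegral => x _; rewrite mulrC. Qed.

Lemma ae_eq_L2inner f f' g : L2 mu f -> L2 mu f' -> L2 mu g ->
  (\forall x \ae mu, f x = f' x) -> L2inner mu f g = L2inner mu f' g.
Proof.
move=> f2 f'2 g2 ff'; congr fine; apply: ae_eq_integral => //.
- exact: measurable_int (L2_integrableM f2 g2).
- exact: measurable_int (L2_integrableM f'2 g2).
by apply: filterS ff' => x -> _.
Qed.

End L2_space.

(** * Jensen's inequality for the square *)

Section jensen.
Context {d} {E : measurableType d} {R : realType} (m : {measure set E -> \bar R}).
Hypothesis m1 : m setT = 1%E.

(** [|f|] is dominated by [1 + f ^+ 2], which is integrable because the mass is finite. *)
Lemma integrable_of_sqr (f : E -> R) : measurable_fun setT f ->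
  (\int[m]_x (f x * f x)%:E < +oo)%E -> m.-integrable setT (EFin \o f).
Proof.
move=> mf f2.
have i1 : m.-integrable setT (cst 1%E : E -> \bar R).
  by apply/integrableP; split => //; rewrite /= integral_cst// m1 mule1 normr1 ltry.
have i2 : m.-integrable setT (fun x => (f x * f x)%:E).
  apply/integrableP; split; first exact/measurable_EFinP/measurable_funM.
  by under eq_integral do rewrite gee0_abs ?lee_fin -?expr2 ?sqr_ge0 ?expr2//.
apply: (le_integrable _ _ _ (integrableD _ i1 i2)) => //; first exact/measurable_EFinP.
move=> x _ /=; rewrite lee_fin (le_trans _ (ler_norm _))//.
by rewrite ler_norml; have := sqr_ge0 (f x - 1); have := sqr_ge0 (f x + 1); nra.
Qed.

(** The difference of the two sides is the variance, the integral of [(f - a) ^+ 2] with [a] the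
    mean; an infinite right side is trivial. *)
Lemma sqr_Rintegral_le (f : E -> R) : measurable_fun setT f ->
  (((\int[m]_x f x) * (\int[m]_x f x))%:E <= \int[m]_x (f x * f x)%:E)%E.
Proof.
move=> mf; have [f2|] := ltP (\int[m]_x (f x * f x)%:E)%E +oo%E; last first.
  by rewrite leye_eq => /eqP ->; exact: leey.
have if1 := integrable_of_sqr mf f2.
have i2 : m.-integrable setT (EFin \o (fun x => f x * f x)).
  apply/integrableP; split; first exact/measurable_EFinP/measurable_funM.
  by under eq_integral do rewrite gee0_abs ?lee_fin -?expr2 ?sqr_ge0 ?expr2//.
have i0 (c : R) : m.-integrable setT (EFin \o cst c : E -> \bar R).
  apply/integrableP; split; first exact/measurable_EFinP.
  by rewrite (eq_integral (cst `|c%:E|%E))// integral_cst// m1 mule1 ltry.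
rewrite -[leRHS]fineK ?integrable_fin_num// lee_fin -subr_ge0.
set a := \int[m]_x f x.
suff -> : fine (\int[m]_x (f x * f x)%:E) - a * a = \int[m]_x ((f x - a) * (f x - a)).
  by apply: Rintegral_ge0 => x _; rewrite -expr2 sqr_ge0.
have E1 x : (f x - a) * (f x - a) = (f x * f x + - (2 * a) * f x) + a * a by ring.
under [RHS]eq_Rintegral do rewrite E1.
have iZ : m.-integrable setT (EFin \o (fun x => - (2 * a) * f x)).
  exact: (integrableZl _ _ if1).
rewrite RintegralD//; last 2 first.
- exact: (integrableD _ i2 iZ).
- exact: i0.
rewrite RintegralD// RintegralZl// Rintegral_cst// m1 /= -/a mulr1.
by rewrite /Rintegral; ring.
Qed.

End jensen.

(** * Integration against a measure composed with a kernel *)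

Section disintegration.
Context {d} {E : measurableType d} {R : realType}.
Variables (k : R.-pker E ~> E) (m m' : {measure set E -> \bar R}).
(** Two instances matter: [m] and [m'] both [mu] (invariance), and [m = p s x], [m' = p (s + t) x]
    (Chapman-Kolmogorov), with [k = p t] in both. *)
Hypothesis m'E : forall g : E -> \bar R, (forall y, 0 <= g y)%E ->
  measurable_fun [set: E] g ->
  (\int[m']_y g y = \int[m]_x \int[k x]_y g y)%E.

Lemma measurable_integral_kernel (g : E -> \bar R) : (forall y, 0 <= g y)%E ->
  measurable_fun [set: E] g -> measurable_fun [set: E] (fun x => \int[k x]_y g y)%E.
Proof.
by move=> g0 mg; apply: measurable_fun_integral_kernel => // U; exact: measurable_kernel.
Qed.

Lemma measurable_Rintegral_kernel (f : E -> R) : measurable_fun setT f ->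
  measurable_fun setT (fun x => \int[k x]_y f y).
Proof.
move=> mf; have mf' : measurable_fun setT (EFin \o f) by exact/measurable_EFinP.
apply: (measurableT_comp (fine_measurable measurableT)).
rewrite (_ : (fun _ => _) = (fun x => \int[k x]_y (EFin \o f)^\+ y -
    \int[k x]_y (EFin \o f)^\- y)%E); last first.
  by apply/funext => x; rewrite integralE.
apply: emeasurable_funB; apply: measurable_integral_kernel => //.
- exact: measurable_funepos.
- exact: measurable_funeneg.
Qed.

Lemma integrable_integral_kernel (g : E -> \bar R) : (forall y, 0 <= g y)%E ->
  measurable_fun [set: E] g -> (\int[m']_y g y < +oo)%E ->
  m.-integrable setT (fun x => \int[k x]_y g y)%E.
Proof.
move=> g0 mg gfin; apply/integrableP; split; first exact: measurable_integral_kernel.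
under eq_integral do rewrite gee0_abs ?integral_ge0//.
by rewrite -m'E.
Qed.

Lemma ae_integrable_kernel (f : E -> R) : m'.-integrable setT (EFin \o f) ->
  \forall x \ae m, (k x).-integrable setT (EFin \o f).
Proof.
move=> /integrableP[mf ffin].
have mn : measurable_fun [set: E] (fun y => `|(EFin \o f) y|)%E.
  exact: measurableT_comp.
have := integrable_ae measurableT (integrable_integral_kernel _ mn ffin).
move=> /(_ (fun=> abse_ge0 _)); apply: filterS => x /(_ Logic.I) xfin.
apply/integrableP; split => //.
by rewrite -ge0_fin_numE// integral_ge0.
Qed.

(** Split into positive and negative parts. The inner real integral is the difference of the two
    parts only where [f] is [k x]-integrable, that is [m]-almost everywhere. *)
Lemma Rintegral_kernel (f : E -> R) : m'.-integrable setT (EFin \o f) ->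
  \int[m]_x \int[k x]_y f y = \int[m']_y f y.
Proof.
move=> fi; have /integrableP[mf ffin] := fi.
have mp := measurable_funepos mf; have mn := measurable_funeneg mf.
have ip := integrable_funepos measurableT fi.
have in_ := integrable_funeneg measurableT fi.
have iP : m.-integrable setT (fun x => \int[k x]_y (EFin \o f)^\+ y)%E.
  apply: integrable_integral_kernel => //.
  by case/integrableP : ip => _; under eq_integral do rewrite gee0_abs//.
have iN : m.-integrable setT (fun x => \int[k x]_y (EFin \o f)^\- y)%E.
  apply: integrable_integral_kernel => //.
  by case/integrableP : in_ => _; under eq_integral do rewrite gee0_abs//.
rewrite [RHS]/Rintegral integralE !m'E// -integralB//; congr fine.
apply: ae_eq_integral => //.
- exact/measurable_EFinP/measurable_Rintegral_kernel/measurable_EFinP.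
- exact: emeasurable_funB (measurable_int m iP) (measurable_int m iN).
apply: filterS (ae_integrable_kernel fi) => x ix _.
by rewrite -integralE /Rintegral fineK// integrable_fin_num.
Qed.

End disintegration.

(** * Transition operators as contractions satisfying the semigroup law *)

Section transition_operator.
Context {d} {E : measurableType d} {R : realType} (p : R -> R.-pker E ~> E).
Implicit Types (f g : E -> R) (s t : R).

Variable mu : probability E R.
Hypothesis p_trans : transition_function p.
Hypothesis mu_inv : invariant_probability p mu.

Lemma integral_mu t (g : E -> \bar R) : 0 <= t -> (forall y, 0 <= g y)%E ->
  measurable_fun [set: E] g ->
  (\int[mu]_y g y = \int[mu]_x \int[p t x]_y g y)%E.
Proof. by move=> t0; apply: integral_invariant => A mA; exact: mu_inv. Qed.

Lemma integral_p s t x (g : E -> \bar R) : 0 <= s -> 0 <= t -> (forall y, 0 <= g y)%E ->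
  measurable_fun [set: E] g ->
  (\int[p (s + t) x]_y g y = \int[p s x]_y \int[p t y]_z g z)%E.
Proof.
move=> s0 t0; apply: integral_chapman_kolmogorov => A mA.
by case: p_trans => _; apply.
Qed.

(** Jensen's inequality for each probability [p t x], integrated by invariance. *)
Lemma transition_op_sqr_le t f : 0 <= t -> measurable_fun setT f ->
  (\int[mu]_x (transition_op p t f x * transition_op p t f x)%:E <=
   \int[mu]_x (f x * f x)%:E)%E.
Proof.
move=> t0 mf.
have mff : measurable_fun [set: E] (fun y => (f y * f y)%:E).
  exact/measurable_EFinP/measurable_funM.
have ff0 y : (0 <= (f y * f y)%:E)%E by rewrite lee_fin -expr2 sqr_ge0.
rewrite (integral_mu t0 ff0 mff); apply: ge0_le_integral => //.
- by move=> x _; rewrite lee_fin -expr2 sqr_ge0.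
- by apply/measurable_EFinP/measurable_funM; exact: measurable_Rintegral_kernel.
- exact: measurable_integral_kernel.
by move=> x _; apply: sqr_Rintegral_le => //; exact: prob_kernel.
Qed.

Lemma L2_transition_op t f : 0 <= t -> L2 mu f -> L2 mu (transition_op p t f).
Proof.
move=> t0 /L2P[mf ffin]; apply/L2P; split; first exact: measurable_Rintegral_kernel.
exact: le_lt_trans (transition_op_sqr_le t0 mf) ffin.
Qed.

Lemma L2norm_transition_op t f : 0 <= t -> L2 mu f ->
  L2norm mu (transition_op p t f) <= L2norm mu f.
Proof.
move=> t0 f2; have Pf2 := L2_transition_op t0 f2.
rewrite !L2norm_sqrt ler_wsqrtr// fine_le ?transition_op_sqr_le//.
- exact: integrable_fin_num (L2_integrableM Pf2 Pf2).
- exact: integrable_fin_num (L2_integrableM f2 f2).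
- exact: L2_measurable f2.
Qed.

Lemma ae_integrable_p t f : 0 <= t -> L2 mu f ->
  \forall x \ae mu, (p t x).-integrable setT (EFin \o f).
Proof.
move=> t0 f2; apply: ae_integrable_kernel (L2_integrable f2).
by move=> g; exact: integral_mu.
Qed.

Lemma Rintegral_transition_op t f : 0 <= t -> L2 mu f ->
  \int[mu]_x transition_op p t f x = \int[mu]_x f x.
Proof.
move=> t0 f2; apply: Rintegral_kernel (L2_integrable f2) => g.
exact: integral_mu.
Qed.

Lemma transition_op_comp s t f : 0 <= s -> 0 <= t -> L2 mu f ->
  \forall x \ae mu, transition_op p s (transition_op p t f) x = transition_op p (s + t) f x.
Proof.
move=> s0 t0 f2; apply: filterS (ae_integrable_p (addr_ge0 s0 t0) f2) => x ix.
by apply: Rintegral_kernel ix => g; exact: integral_p.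
Qed.

Lemma transition_op0 f x : measurable_fun setT f -> transition_op p 0 f x = f x.
Proof.
move=> mf; rewrite /transition_op /Rintegral.
have -> : (\int[p 0 x]_y (f y)%:E = \int[\d_x]_y (f y)%:E)%E.
  by apply: eq_measure_integral => A mA _; case: p_trans => -> .
by rewrite integral_dirac// ?diracT ?mul1e//; exact/measurable_EFinP.
Qed.

Lemma transition_op_linear t (a : R) f g : 0 <= t -> L2 mu f -> L2 mu g ->
  \forall x \ae mu, transition_op p t (fun y => a * f y + g y) x =
    a * transition_op p t f x + transition_op p t g x.
Proof.
move=> t0 f2 g2; have := ae_integrable_p t0 f2; have := ae_integrable_p t0 g2.
apply: filterS2 => x gi fi; rewrite /transition_op RintegralD//.
  by rewrite RintegralZl.
exact: (integrableZl _ _ fi).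
Qed.

End transition_operator.

(** * Completeness of L^2 *)

Section completeness.
Context {d} {E : measurableType d} {R : realType} (mu : probability E R).
Implicit Types f g : E -> R.

Lemma L2_lincomb (a : R) f g : L2 mu f -> L2 mu g -> L2 mu (fun x => a * f x + g x).
Proof.
move=> f2 g2; have p1 : (1 <= 2%:E :> \bar R)%E by rewrite lee_fin ler1n.
by have := Lfun_submod_closed mu p1 => -[_ /(_ a f g f2 g2)].
Qed.

Lemma L2B f g : L2 mu f -> L2 mu g -> L2 mu (fun x => f x - g x).
Proof.
move=> f2 g2; have := L2_lincomb (-1) g2 f2.
by congr L2; apply/funext => x; rewrite mulN1r addrC.
Qed.

Lemma L2normD f g : L2 mu f -> L2 mu g ->
  L2norm mu (fun x => f x + g x) <= L2norm mu f + L2norm mu g.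
Proof.
move=> f2 g2; have p1 : (1 <= 2%:E :> \bar R)%E by rewrite lee_fin ler1n.
exact: (ler_LnormD (Lfun_Sub p1 f2) (Lfun_Sub p1 g2)).
Qed.

Lemma integral_norm_le_L2norm f : L2 mu f ->
  (\int[mu]_x `|(f x)%:E| <= (L2norm mu f)%:E)%E.
Proof.
move=> f2; have fi := integrable_norm (L2_integrable f2).
have mf : measurable_fun setT (fun x => `|f x|).
  exact: measurableT_comp (L2_measurable f2).
rewrite [leLHS](_ : _ = (\int[mu]_x `|f x|)%:E); last first.
  by rewrite /Rintegral fineK//; exact: integrable_fin_num fi.
have := sqr_Rintegral_le (probability_setT mu) mf.
under [leRHS]eq_integral do rewrite -normrM ger0_norm -?expr2 ?sqr_ge0 ?expr2//.
rewrite L2norm_sqrt !lee_fin => le.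
rewrite -[leLHS]ger0_norm; last by apply: Rintegral_ge0 => x _.
rewrite -sqrtr_sqr ler_wsqrtr// expr2 -lee_fin (le_trans le)//.
by rewrite /L2inner /Rintegral fineK// integrable_fin_num// L2_integrableM.
Qed.

Lemma nneseries_lty_cvg (w : nat -> R) :
  (\sum_(k <oo) `|(w k)%:E| < +oo)%E -> cvgn (series w).
Proof.
move=> wfin; apply: normed_cvg; apply: nondecreasing_is_cvgn.
  by apply: nondecreasing_series => n _ _; exact: normr_ge0.
exists (fine (\sum_(k <oo) `|(w k)%:E|)%E) => _ [n _ <-].
rewrite -lee_fin fineK; last first.
  by rewrite ge0_fin_numE// nneseries_ge0.
rewrite /series /= -sumEFin; exact: (@nneseries_lim_ge _ (fun k => `|(w k)%:E|%E) xpredT 0%N n).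
Qed.

(** The increments have summable integrals, so the sequence converges almost everywhere; Fatou's
    lemma carries the quadratic bounds to the limit. *)
Lemma riesz_fischer_fast (v : nat -> E -> R) : (forall n, L2 mu (v n)) ->
  (forall k n, (k <= n)%N -> L2norm mu (fun x => v k x - v n x) <= 1 / (2 ^ k.+1)%:R) ->
  exists2 g, L2 mu g &
    forall k, L2norm mu (fun x => v k x - g x) <= 1 / (2 ^ k.+1)%:R.
Proof.
move=> v2 vP; pose w k x := v k.+1 x - v k x.
have w2 k : L2 mu (w k) by exact: L2B.
have mw k : measurable_fun [set: E] (fun x => `|(w k x)%:E|%E).
  by apply: measurableT_comp => //; apply/measurable_EFinP; exact: L2_measurable.
have wn k : (\int[mu]_x `|(w k x)%:E| <= (1 / (2 ^ k.+1)%:R)%:E)%E.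
  rewrite (le_trans (integral_norm_le_L2norm (w2 k)))// lee_fin.
  rewrite (le_trans _ (vP k k.+1 (leqnSn k)))// !L2norm_sqrt /L2inner.
  by rewrite le_eqVlt; apply/orP; left; apply/eqP; congr Num.sqrt;
    apply: eq_Rintegral => x _; rewrite /w; ring.
have wfin : (\int[mu]_x (\sum_(k <oo) `|(w k x)%:E|) < +oo)%E.
  rewrite integral_nneseries//.
  apply: le_lt_trans (le_lt_trans (@epsilon_trick0 R 1 xpredT ler01) (ltry _)).
  by apply: lee_nneseries => k _; rewrite ?integral_ge0.
have mS : measurable_fun [set: E] (fun x => \sum_(k <oo) `|(w k x)%:E|)%E.
  by apply: ge0_emeasurable_sum.
have aecvg : \forall x \ae mu, cvgn (v ^~ x).
  have iS : mu.-integrable setT (fun x => \sum_(k <oo) `|(w k x)%:E|)%E.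
    apply/integrableP; split => //.
    by under eq_integral do rewrite gee0_abs ?nneseries_ge0//.
  have := integrable_ae measurableT iS; apply: filterS => x /(_ Logic.I).
  rewrite ge0_fin_numE ?nneseries_ge0// => /nneseries_lty_cvg cw.
  have -> : v ^~ x = (fun n => v 0%N x + series (w ^~ x) n).
    by apply/funext => n; rewrite seriesEnat /= telescope_sumr// addrC subrK.
  by apply: is_cvgD => //; exact: is_cvg_cst.
(* The limit of [v], and a measurable function where [v] diverges. *)
pose g x := fine (limn_esup (fun n => (v n x)%:E)).
have mg : measurable_fun setT g.
  apply: (measurableT_comp (fine_measurable measurableT)).
  apply: measurable_fun_limn_esup => n.
  by apply/measurable_EFinP; exact: L2_measurable.
have gE x : cvgn (v ^~ x) -> v ^~ x @ \oo --> g x.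
  move=> /cvg_ex[l vl]; suff -> : g x = l by [].
  have vl' : (fun n => (v n x)%:E) @ \oo --> l%:E by apply: cvg_EFin; [exact: nearW|exact: vl].
  by rewrite /g limn_esup_lim; have /cvg_lim -> := cvg_esups vl'.
have key k : (\int[mu]_x ((v k x - g x) * (v k x - g x))%:E <=
    ((1 / (2 ^ k.+1)%:R) ^+ 2)%:E)%E.
  pose f n x := ((v k x - v n x) * (v k x - v n x))%:E.
  have mf n : measurable_fun [set: E] (f n).
    apply/measurable_EFinP/measurable_funM; apply: L2_measurable; exact: L2B.
  have f0 n x : setT x -> (0 <= f n x)%E by move=> _; rewrite lee_fin -expr2 sqr_ge0.
  have -> : (\int[mu]_x ((v k x - g x) * (v k x - g x))%:E =
      \int[mu]_x limn_einf (f ^~ x))%E.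
    apply: ae_eq_integral => //.
    - by apply/measurable_EFinP/measurable_funM; apply: measurable_funB => //; exact: L2_measurable.
    - rewrite (_ : (fun _ => _) =
          (fun x => - limn_esup (fun n => - f n x))%E)//.
      apply: measurableT_comp => //; apply: measurable_fun_limn_esup => n.
      exact: measurableT_comp.
    apply: filterS aecvg => x /gE vg _.
    have fg : f ^~ x @ \oo --> ((v k x - g x) * (v k x - g x))%:E.
      apply: cvg_EFin; first exact: nearW.
      by apply: cvgM; apply: cvgB => //; exact: cvg_cst.
    by rewrite limn_einf_lim; have /cvg_lim -> := cvg_einfs fg.
  rewrite (le_trans (fatou mu measurableT mf f0))// limn_einf_lim.
  apply: lime_le; first exact: is_cvg_einfs.
  (* The index [maxn k n] lies in the tail from [n] and is at least [k], as [vP] requires. *)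
  apply: nearW => n; apply: (@le_trans _ _ (\int[mu]_x f (maxn k n) x)%E).
    by apply: ereal_inf_lbound; exists (maxn k n) => //=; exact: leq_maxr.
  have fi := integrable_fin_num measurableT (L2_integrableM (L2B (v2 k) (v2 (maxn k n))) (L2B (v2 k) (v2 (maxn k n)))).
  rewrite /f -[leLHS]fineK// lee_fin.
  have := vP k (maxn k n) (leq_maxl _ _); rewrite L2norm_sqrt => le.
  rewrite -[leLHS]sqr_sqrtr; last by apply: fine_ge0; apply: integral_ge0 => x _; exact: f0.
  by rewrite ler_pXn2r ?nnegrE ?sqrtr_ge0.
have kfin k : (\int[mu]_x ((v k x - g x) * (v k x - g x))%:E < +oo)%E.
  exact: le_lt_trans (key k) (ltry _).
exists g.
  have : L2 mu (fun x => v 0%N x - (v 0%N x - g x)).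
    apply: L2B => //; apply/L2P; split; last exact: kfin.
    by apply: measurable_funB => //; exact: L2_measurable.
  by congr L2; apply/funext => x; ring.
move=> k; rewrite L2norm_sqrt -[leRHS]ger0_norm// -sqrtr_sqr ler_wsqrtr//.
rewrite -lee_fin /L2inner /Rintegral fineK// ge0_fin_numE ?kfin// integral_ge0// => x _.
by rewrite lee_fin -expr2 sqr_ge0.
Qed.

Lemma riesz_fischer (u : nat -> E -> R) : (forall n, L2 mu (u n)) ->
  (forall e : R, 0 < e -> exists n0, forall m n, (n0 <= m)%N -> (n0 <= n)%N ->
    L2norm mu (fun x => u m x - u n x) <= e) ->
  exists2 g, L2 mu g & forall e : R, 0 < e -> exists n0, forall n, (n0 <= n)%N ->
    L2norm mu (fun x => u n x - g x) <= e.
Proof.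
move=> u2 uP.
have h0 k : 0 < 1 / (2 ^ k.+1)%:R :> R by rewrite divr_gt0// ltr0n expn_gt0.
have /choice[phi phiP] k : exists n0, forall m n, (n0 <= m)%N -> (n0 <= n)%N ->
    L2norm mu (fun x => u m x - u n x) <= 1 / (2 ^ k.+1)%:R by exact: uP.
(* Partial sums make the thresholds monotone: [N n] exceeds or equals [phi k] for every [k <= n]. *)
pose N k := (\sum_(i < k.+1) phi i)%N.
have phiN k n : (k <= n)%N -> (phi k <= N n)%N.
  by move=> kn; rewrite /N (bigD1 (Ordinal (kn : (k < n.+1)%N)))//= leq_addr.
have [g g2 gP] := @riesz_fischer_fast (fun k => u (N k)) (fun k => u2 _)
  (fun k n kn => phiP k _ _ (phiN k k (leqnn k)) (phiN k n kn)).
exists g => // e e0.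
have [k /(_ k (leqnn _)) ke] := small_mesh 1 (divr_gt0 e0 (ltr0n _ 2)).
have {}ke : 1 / (2 ^ k.+1)%:R <= e / 2.
  rewrite (le_trans _ ke)// !div1r lef_pV2 ?posrE ?ltr0n ?expn_gt0//.
  by rewrite ler_nat ltnW// ltn_expl.
exists (phi k) => n kn.
have := L2normD (L2B (u2 n) (u2 (N k))) (L2B (u2 (N k)) g2).
rewrite (_ : (fun x => _ + _) = (fun x => u n x - g x)); last first.
  by apply/funext => x; ring.
move=> /le_trans; apply; rewrite [e]splitr lerD//.
  exact: le_trans (phiP k _ _ kn (phiN k k (leqnn k))) ke.
exact: le_trans (gP k) ke.
Qed.

End completeness.

(** * The flow Poincare inequality *)

Lemma cvg_at_right0P {R : realType} (u : R -> R) : (forall h, 0 <= u h) ->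
  u h @[h --> 0^'+] --> (0 : R) <->
  forall e : R, 0 < e -> exists2 d : R, 0 < d & forall h, 0 < h -> h <= d -> u h <= e.
Proof.
move=> u0; split=> [/cvgrPdist_le uP e e0 | uP].
  have /nbhs_ballP[d /= d0 dP] := uP _ e0.
  exists (d / 2) => [|h h0 hd]; first by rewrite divr_gt0.
  have := dP h; rewrite /ball /= sub0r normrN sub0r normrN !ger0_norm ?(ltW h0)//.
  by apply => //; rewrite (le_lt_trans hd)// ltr_pdivrMr// ltr_pMr// ltr1n.
apply/cvgrPdist_le => e e0; have [d d0 dP] := uP _ e0.
near=> h; rewrite sub0r normrN ger0_norm//; apply: dP.
- by near: h; exact: nbhs_right_gt.
- by near: h; exact: nbhs_right_le.
Unshelve. all: by end_near. Qed.

Section L2_semigroup.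
Context {d} {E : measurableType d} {R : realType} (mu : probability E R).
Variables (p : R -> R.-pker E ~> E).
Hypotheses (p_trans : transition_function p) (mu_inv : invariant_probability p mu).
Hypothesis p_cont : strongly_continuous p mu.

Let p1 : (1 <= 2%:E :> \bar R)%E. Proof. by rewrite lee_fin ler1n. Qed.

(** Functions and not classes, whence the degenerate inner product of the abstract part. *)
Let V := LfunType mu p1.
Implicit Types (f g h : V) (s t : R).

Let VP f : L2 mu f. Proof. exact: LfunP. Qed.

Let ip f g : R := L2inner mu f g.

(* For t < 0 the function [transition_op p t f] need not be in L^2, hence the
   default value 0. *)
Let P t f : V := insubd 0 (transition_op p t f).

Let PE t f : 0 <= t -> P t f = transition_op p t f :> (E -> R).
Proof. by move=> t0; apply: insubdK; exact: L2_transition_op. Qed.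

Let nmE f : nm ip f = L2norm mu f.
Proof. by rewrite L2norm_sqrt. Qed.

Let ipC f g : ip f g = ip g f. Proof. exact: L2innerC. Qed.

Let ip_linear (a : R) f g h : ip (a *: f + g) h = a * ip f h + ip g h.
Proof. exact: (L2inner_linear a (VP f) (VP g) (VP h)). Qed.

Let ip_ge0 f : 0 <= ip f f. Proof. exact: L2inner_ge0. Qed.

Let complete (u : nat -> V) :
  (forall e : R, 0 < e -> exists n0, forall m n, (n0 <= m)%N -> (n0 <= n)%N ->
    nm ip (u m - u n) <= e) ->
  exists x, forall e : R, 0 < e -> exists n0, forall n, (n0 <= n)%N ->
    nm ip (u n - x) <= e.
Proof.
move=> uP; have [|g g2 gP] := @riesz_fischer _ _ _ mu (fun n => u n : E -> R) (fun n => VP _).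
  move=> e /uP[n0 n0P]; exists n0 => m n n0m n0n.
  by have := n0P m n n0m n0n; rewrite nmE.
exists (Lfun_Sub p1 g2) => e /gP[n0 n0P]; exists n0 => n n0n.
by rewrite nmE; exact: n0P.
Qed.

Let P_linear t (a : R) f g h : 0 <= t ->
  ip (P t (a *: f + g)) h = a * ip (P t f) h + ip (P t g) h.
Proof.
move=> t0; rewrite -ip_linear; apply: ae_eq_L2inner => //.
apply: filterS (transition_op_linear mu_inv a t0 (VP f) (VP g)) => x.
by rewrite /= !PE.
Qed.

Let P_comp s t f h : 0 <= s -> 0 <= t -> ip (P s (P t f)) h = ip (P (s + t) f) h.
Proof.
move=> s0 t0; apply: ae_eq_L2inner => //.
apply: filterS (transition_op_comp p_trans mu_inv s0 t0 (VP f)) => x.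
by rewrite !PE ?addr_ge0.
Qed.

Let P_0 f h : ip (P 0 f) h = ip f h.
Proof.
by congr L2inner; apply/funext => x; rewrite PE// transition_op0.
Qed.

Let P_contr t f : 0 <= t -> nm ip (P t f) <= nm ip f.
Proof. by move=> t0; rewrite !nmE PE// L2norm_transition_op. Qed.

Let P_cont f (e : R) : 0 < e ->
  exists2 d : R, 0 < d & forall t, 0 < t -> t <= d -> nm ip (P t f - f) <= e.
Proof.
have /cvg_at_right0P H := p_cont (VP f).
move=> /(H (fun=> fine_ge0 (Lnorm_ge0 _ _ _)))[d' d0 dP]; exists d' => // t t0 td.
by rewrite nmE; have := dP t t0 td; rewrite -PE// ltW.
Qed.

Let one : V := Lfun_Sub p1 (L2_cst mu 1).

Let ip_one f : ip f one = \int[mu]_x f x.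
Proof. by apply: eq_Rintegral => x _; rewrite mulr1. Qed.

Let P_one t f : 0 <= t -> ip (P t f) one = ip f one.
Proof. by move=> t0; rewrite !ip_one PE// Rintegral_transition_op. Qed.

Let genE f g : gen ip P f g <-> generator_rel p mu f g.
Proof.
have nE t : 0 < t -> nm ip (t^-1 *: (P t f - f) - g) =
    L2norm mu (fun x => t^-1 * (transition_op p t f x - f x) - g x).
  by move=> t0; rewrite nmE -PE ?ltW.
have n0 t : 0 <= L2norm mu (fun x => t^-1 * (transition_op p t f x - f x) - g x).
  exact: fine_ge0 (Lnorm_ge0 _ _ _).
split=> [fg|[_ _ /(cvg_at_right0P n0) fg]].
  split => //; apply/(cvg_at_right0P n0) => e /fg[d' d0 dP].
  by exists d' => // t t0 td; rewrite -nE// dP.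
by move=> e /fg[d' d0 dP]; exists d' => // t t0 td; rewrite nE// dP.
Qed.

(** The representative picked by [generator] differs from [g] by a null vector, which inner products
    do not see. *)
Let ip_generator f g h : gen ip P f g -> ip h (- g) = L2inner mu h (fun x => - generator p mu f x).
Proof.
move=> /genE fg.
have : generator_rel p mu f (generator p mu f).
  exact: (@xgetPex _ (cst 0) [set g | generator_rel p mu f g] (ex_intro _ _ fg)).
move=> fg'; have [_ g'2 _] := fg'.
pose g' : V := Lfun_Sub p1 g'2.
have gg0 := gen_unique ipC ip_linear ip_ge0 ((genE _ _).2 fg) ((genE f g').2 fg').
have /eqP := nm0_ip ipC ip_linear ip_ge0 h gg0.
rewrite (ipBl ip_linear) subr_eq0 => /eqP gg'.
have ipNr x : ip h (- x) = - ip x h by rewrite ipC -scaleN1r (ipZl ip_linear) mulN1r.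
by rewrite ipNr gg' -ipNr.
Qed.

Variables (nu T : R).
Hypotheses (nu0 : 0 < nu) (T0 : 0 < T).

Let I_E f t : 0 <= t ->
  \int[lebesgue_measure]_(s in `[t, t + T]) ip (P s f) (P s f) =
  \int[lebesgue_measure]_(s in `[t, t + T]) L2norm mu (transition_op p s f) ^+ 2.
Proof.
move=> t0; apply: eq_Rintegral => s; rewrite inE /= in_itv /= => /andP[ts _].
have s0 := le_trans t0 ts.
by rewrite L2norm_sqrt sqr_sqrtr ?L2inner_ge0// /ip PE.
Qed.

Let poincareE f g : gen ip P f g -> poincare ip P nu T f <->
  \int[lebesgue_measure]_(t in `[0, T]) L2norm mu (transition_op p t f) ^+ 2
  <= nu^-1 * \int[lebesgue_measure]_(t in `[0, T])
         L2inner mu (transition_op p t f)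
           (fun x => - generator p mu (transition_op p t f) x).
Proof.
move=> fg; rewrite /poincare I_E// add0r.
have -> : (ip f f - ip (P T f) (P T f)) / 2 =
    \int[lebesgue_measure]_(t in `[0, T]) ip (P t f) (- P t g).
  by rewrite (energy_identity ipC ip_linear ip_ge0 P_linear P_comp P_0 P_contr P_cont fg (ltW T0)).
suff -> : \int[lebesgue_measure]_(t in `[0, T]) ip (P t f) (- P t g) =
  \int[lebesgue_measure]_(t in `[0, T]) L2inner mu (transition_op p t f)
           (fun x => - generator p mu (transition_op p t f) x) by [].
apply: eq_Rintegral => t; rewrite inE /= in_itv /= => /andP[t0 _].
rewrite (@ip_generator (P t f)) ?PE//.
exact: (gen_P ipC ip_linear P_linear P_comp P_contr).
Qed.

Let decay := forall (f : E -> R) t, L20 mu f -> 0 <= t ->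
  \int[lebesgue_measure]_(s in `[t, t + T]) L2norm mu (transition_op p s f) ^+ 2
  <= expR (- 2 * nu * t) *
    \int[lebesgue_measure]_(s in `[0, T]) L2norm mu (transition_op p s f) ^+ 2.

Lemma flow_poincare_imp_decay : flow_poincare p mu nu^-1 T -> decay.
Proof.
move=> i f0 t [f2 f1] t0; pose f : V := Lfun_Sub p1 f2.
have := @flow_poincare_decay _ _ _ ipC ip_linear ip_ge0 complete _ P_linear P_comp
  P_0 P_contr P_cont _ _ nu0 T0 _ P_one _ f t.
rewrite !I_E// add0r -!mulNr; apply=> //; last by rewrite ip_one.
move=> g g1 [g' gg']; apply/(poincareE gg'); apply: i.
  by split => //; rewrite -ip_one.
by exists g'; exact/genE.
Qed.

Let decayP (f0 : E -> R) (f02 : L2 mu f0) (f := Lfun_Sub p1 f02 : V) :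
  decay -> \int[mu]_x f0 x = 0 ->
  forall t, 0 <= t -> \int[lebesgue_measure]_(s in `[t, t + T]) ip (P s f) (P s f) <=
    expR (- (2 * nu) * t) *
    \int[lebesgue_measure]_(s in `[0, 0 + T]) ip (P s f) (P s f).
Proof. by move=> D f1 t t0; rewrite !I_E// add0r -!mulNr; exact: D. Qed.

Lemma decay_imp_flow_poincare : decay -> flow_poincare p mu nu^-1 T.
Proof.
move=> D f0 [f2 f1] [g fg].
have [_ g2 _] := fg; pose f : V := Lfun_Sub p1 f2.
have [+ _] := poincareE ((genE f (Lfun_Sub p1 g2)).2 fg); apply.
apply: (decay_flow_poincare ipC ip_linear ip_ge0 P_linear P_comp P_0 P_contr P_cont nu0 T0).
exact: decayP.
Qed.

Lemma decay_imp_pointwise_decay : decay -> forall (f : E -> R) t, L20 mu f -> 0 <= t ->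
  L2norm mu (transition_op p t f) <= expR (nu * T) * expR (- nu * t) * L2norm mu f.
Proof.
move=> D f0 t [f2 f1] t0; pose f : V := Lfun_Sub p1 f2.
have := decay_norm ipC ip_linear ip_ge0 P_linear P_comp P_0 P_contr P_cont nu0 T0
  (@decayP _ f2 D f1) t0.
by rewrite !nmE PE.
Qed.

End L2_semigroup.

Theorem theorem9 (R : realType) (d : measure_display) (E : measurableType d)
    (mu : probability E R) (p : R -> R.-pker E ~> E)
    (p_trans : transition_function p)
    (mu_inv : invariant_probability p mu)
    (p_cont : strongly_continuous p mu)
    (nu T : R) (nu_gt0 : 0 < nu) (T_gt0 : 0 < T) :
  let P := transition_op p in
  let assertion_i := flow_poincare p mu nu^-1 T in
  let assertion_ii := forall (f : E -> R) (t : R), L20 mu f -> 0 <= t ->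
    \int[lebesgue_measure]_(s in `[t, t + T]) L2norm mu (P s f) ^+ 2
    <= expR (- 2 * nu * t) *
       \int[lebesgue_measure]_(s in `[0, T]) L2norm mu (P s f) ^+ 2 in
  let decay := forall (f : E -> R) (t : R), L20 mu f -> 0 <= t ->
    L2norm mu (P t f) <= expR (nu * T) * expR (- nu * t) * L2norm mu f in
  [/\ assertion_i <-> assertion_ii,
      assertion_i -> decay &
      assertion_ii -> decay].
Proof.
split.
- split.
  + exact: flow_poincare_imp_decay.
  + exact: decay_imp_flow_poincare.
- by move=> i; apply: decay_imp_pointwise_decay => //; exact: flow_poincare_imp_decay.
- exact: decay_imp_pointwise_decay.
Qed.
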